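(* Let $s>0$ and $d\in\mathbb{N}$, and let $n\in\mathbb{N}$. (i) If $n\ge 27^d$, then $$a_n(I_d:H^{s,\#}_{\rm mix}(\mathbb{T}^d)\to L_2(\mathbb{T}^d))\le\Big[\frac{3^d}{(d-1)!}\Big]^s\frac{(\ln n)^{(d-1)s}}{n^s}.$$ (ii) If $n>(12\,e^2)^d$, then $$a_n(I_d:H^{s,\#}_{\rm mix}(\mathbb{T}^d)\to L_2(\mathbb{T}^d))\ge\Big[\frac{3}{d!}\Big(\frac{2}{2+\ln 12}\Big)^d\Big]^s\frac{(\ln n)^{(d-1)s}}{n^s}.$$
   Context: $\mathbb{N}=\{1,2,3,\dots\}$. $\mathbb{T}^d$ is the $d$-torus, represented by $[0,2\pi]^d$ with opposite sides identified. $L_2(\mathbb{T}^d)$ carries the norm $\|f|L_2(\mathbb{T}^d)\|=(\int_{\mathbb{T}^d}|f(x)|^2dx)^{1/2}$, and for $f\in L_2(\mathbb{T}^d)$ the Fourier coefficients are $c_k(f)=(2\pi)^{-d/2}\int_{\mathbb{T}^d}f(x)e^{-ikx}dx$, $k\in\mathbb{Z}^d$ (so $\|f|L_2(\mathbb{T}^d)\|^2=\sum_k|c_k(f)|^2$). For $s>0$, $H^{s,\#}_{\rm mix}(\mathbb{T}^d)$ is the space of all $f\in L_2(\mathbb{T}^d)$ for which the norm $$\|f|H^s_{\rm mix}(\mathbb{T}^d)\|^{\#}=\Big[\sum_{k\in\mathbb{Z}^d}|c_k(f)|^2\prod_{j=1}^d(1+|k_j|)^{2s}\Big]^{1/2}$$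 is finite, equipped with this norm. $I_d$ denotes the identical embedding $f\mapsto f$. The approximation numbers of a bounded linear operator $T:X\to Y$ between Banach spaces are $a_n(T:X\to Y)=\inf\{\|T-A:X\to Y\| : A:X\to Y \text{ bounded linear},\ {\rm rank}\,A<n\}$, $n\in\mathbb{N}$. *)

(* Defs.v *)
From HB Require Import structures.
From mathcomp Require Import all_boot all_order all_algebra.
From mathcomp Require Import generic_quotient ring_quotient.
From mathcomp Require Import all_classical all_reals all_analysis.
From mathcomp Require Import measurable_realfun.
From mathcomp Require Import complex ring lra.

Set Implicit Arguments.
Unset Strict Implicit.
Unset Printing Implicit Defensive.

Import Order.TTheory GRing.Theory Num.Theory.
Import numFieldNormedType.Exports.
Import ComplexField.Normc.

Local Open Scope classical_set_scope.
Local Open Scope quotient_scope.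
Local Open Scope complex_scope.
Local Open Scope ring_scope.

Local Notation Re := (@complex.Re _).
Local Notation Im := (@complex.Im _).

Section torus_measure.
Context (R : realType).
Local Notation RT := (measurableTypeR R).

Lemma circle_fin :
  (@lebesgue_measure R `[0%R, (2 * pi)%R]%classic < +oo)%E.
Proof. by rewrite lebesgue_measure_itv/=; case: ifP => _; rewrite ltry. Qed.

Definition circle_measure : {finite_measure set RT -> \bar R} :=
  @mfrestr _ RT R _ _ (measurable_itv `[0%R, (2 * pi)%R]) circle_fin.

Definition tcons (d : nat) (x : RT * d.-tuple RT) : d.+1.-tuple RT :=
  [tuple of x.1 :: x.2].

Lemma measurable_tcons (d : nat) : measurable_fun [set: _] (@tcons d).
Proof. exact: measurable_cons. Qed.

Section step.
Variables (d : nat) (mu : {finite_measure set (d.-tuple RT) -> \bar R}).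

Definition torus_step : set (d.+1.-tuple RT) -> \bar R :=
  pushforward (circle_measure \x mu)%E (@tcons d).

HB.instance Definition _ := Measure.copy torus_step
  (measure_function_pushforward__canonical__measure_function_Measure
     (circle_measure \x mu)%E (@measurable_tcons d)).

Lemma torus_step_fin : fin_num_fun torus_step.
Proof.
apply: lty_fin_num_fun.
suff: ((circle_measure \x mu) [set: RT * d.-tuple RT] < +oo)%E by [].
rewrite -setXTT [ltLHS]product_measure1E//.
by rewrite lte_mul_pinfty// ?fin_num_measure// ltey_eq fin_num_measure.
Qed.

HB.instance Definition _ :=
  Measure_isFinite.Build _ _ _ torus_step torus_step_fin.

End step.

(* The torus is [0, 2 pi]^d inside R^d = d.-tuple R: the measure below is the
   d-fold product of Lebesgue measure restricted to [0, 2 pi] (total mass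
   (2 pi)^d, not normalised), transported along R * R^d -> R^(d+1).  The
   complement of the cube is null, so L_2 of this measure is L_2 of the torus. *)
Fixpoint torus_measure (d : nat) : {finite_measure set (d.-tuple RT) -> \bar R} :=
  if d is d'.+1 then torus_step (torus_measure d') else dirac [tuple].

End torus_measure.

Section complex_square_integrable.
Context d (T : measurableType d) (R : realType).

Definition measurable_cfun (f : T -> R[i]) : Prop :=
  measurable_fun [set: T] (Re \o f) /\ measurable_fun [set: T] (Im \o f).

Lemma normc_sqE (z : R[i]) : normc z ^+ 2 = Re z ^+ 2 + Im z ^+ 2.
Proof. by case: z => a b /=; rewrite sqr_sqrtr// addr_ge0// sqr_ge0. Qed.

Lemma normc_sqD (z w : R[i]) :
  normc (z + w) ^+ 2 <= 2 * (normc z ^+ 2 + normc w ^+ 2).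
Proof.
rewrite !normc_sqE; case: z w => [a b] [e f] /=.
rewrite -subr_ge0 (_ : _ - _ = (a - e) ^+ 2 + (b - f) ^+ 2); last by ring.
by rewrite addr_ge0// sqr_ge0.
Qed.

Lemma measurable_cfun_normc_sq (f : T -> R[i]) : measurable_cfun f ->
  measurable_fun [set: T] (fun x => normc (f x) ^+ 2).
Proof.
move=> [mr mi].
rewrite (_ : (fun _ => _) = (fun x => (Re \o f) x ^+ 2 + (Im \o f) x ^+ 2)).
  by apply: measurable_funD; exact: measurable_funX.
by apply/funext => x; rewrite normc_sqE.
Qed.

Lemma ReZD (a z w : R[i]) :
  Re (a * z + w) = (Re a * Re z - Im a * Im z) + Re w.
Proof. by case: a z w => [? ?] [? ?] [? ?]. Qed.

Lemma ImZD (a z w : R[i]) :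
  Im (a * z + w) = (Re a * Im z + Im a * Re z) + Im w.
Proof. by case: a z w => [? ?] [? ?] [? ?]. Qed.

Lemma measurable_cfunZD (a : R[i]) (f g : T -> R[i]) :
  measurable_cfun f -> measurable_cfun g -> measurable_cfun (a *: f + g).
Proof.
move=> [fr fi] [gr gi]; split.
- rewrite (_ : _ \o _ = (fun x => (Re a * (Re \o f) x - Im a * (Im \o f) x)
                                  + (Re \o g) x)).
    by apply: measurable_funD => //; apply: measurable_funB;
       apply: measurable_funM.
  by apply/funext => x; rewrite -ReZD.
- rewrite (_ : _ \o _ = (fun x => (Re a * (Im \o f) x + Im a * (Re \o f) x)
                                  + (Im \o g) x)).
    by apply: measurable_funD => //; apply: measurable_funD;
       apply: measurable_funM.
  by apply/funext => x; rewrite -ImZD.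
Qed.

Variable mu : {measure set T -> \bar R}.

Definition l2_pred : {pred T -> R[i]} := mem [set f : T -> R[i] |
  measurable_cfun f /\ (\int[mu]_x (normc (f x) ^+ 2)%:E < +oo)%E].

Lemma l2_submod_closed : submod_closed l2_pred.
Proof.
split.
  rewrite inE; split; first by split; exact: measurable_cst.
  rewrite (eq_integral (cst 0%E)) ?integral0 ?ltry// => x _.
  by transitivity (normc (0 : R[i]) ^+ 2)%:E => //; rewrite normc0 expr0n.
move=> a f g; rewrite !inE => -[mf fi] [mg gi].
split; first exact: measurable_cfunZD.
have sq0 (h : T -> R[i]) x : [set: T] x -> (0 <= (normc (h x) ^+ 2)%:E)%E.
  by rewrite lee_fin sqr_ge0.
have msq (h : T -> R[i]) : measurable_cfun h ->
    measurable_fun [set: T] (fun x => (normc (h x) ^+ 2)%:E).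
  by move=> mh; exact/measurable_EFinP/measurable_cfun_normc_sq.
have a0 : (0 <= (2 * normc a ^+ 2)%:E)%E by rewrite lee_fin mulr_ge0// sqr_ge0.
have a0' : (0 <= 2%:E :> \bar R)%E by rewrite lee_fin.
apply: (@le_lt_trans _ _ (\int[mu]_x
   ((2 * normc a ^+ 2)%:E * (normc (f x) ^+ 2)%:E
    + 2%:E * (normc (g x) ^+ 2)%:E))%E).
  apply: ge0_le_integral => //; first exact: sq0.
    exact: (msq _ (measurable_cfunZD a mf mg)).
    by apply: emeasurable_funD; apply: measurable_funeM; exact: msq.
  move=> x _; rewrite -!EFinM -EFinD lee_fin.
  apply: le_trans (normc_sqD _ _) _.
  by rewrite [normc ((a *: f) x)]normcM exprMn mulrDr mulrA.
rewrite ge0_integralD//; last 4 first.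
- by move=> x _; rewrite mule_ge0// sq0.
- by apply: measurable_funeM; exact: msq.
- by move=> x _; rewrite mule_ge0// sq0.
- by apply: measurable_funeM; exact: msq.
rewrite !ge0_integralZl//; [|by [exact: msq|exact: sq0]..].
by rewrite lte_add_pinfty// lte_mul_pinfty.
Qed.

HB.instance Definition _ := GRing.isSubmodClosed.Build _ _ l2_pred
  l2_submod_closed.

Record l2_fun := L2Fun {
  l2_fun_val :> T -> R[i];
  l2_fun_valP : l2_fun_val \in l2_pred }.

HB.instance Definition _ := [isSub for l2_fun_val].
HB.instance Definition _ := [Choice of l2_fun by <:].
HB.instance Definition _ := [SubChoice_isSubLmodule of l2_fun by <:].

Definition l2_null : {pred l2_fun} :=
  mem [set f : l2_fun | {ae mu, forall x, f x = 0}].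

Lemma l2_null_submod_closed : submod_closed l2_null.
Proof.
split; first by rewrite inE; exact: aeW.
move=> a f g; rewrite !inE => f0 g0.
apply: filterS2 f0 g0 => x /= fx gx.
by transitivity (a * f x + g x) => //; rewrite fx gx mulr0 addr0.
Qed.

HB.instance Definition _ := GRing.isSubmodClosed.Build _ _ l2_null
  l2_null_submod_closed.

(* L_2(mu; C): square-integrable complex functions modulo a.e. equality
   (see l2_piP), as a vector space over R[i]. *)
Definition L2 := Quotient.quot l2_null.
HB.instance Definition _ := GRing.Zmodule.on L2.
HB.instance Definition _ := EqQuotient.on L2.

Lemma l2_piP (f g : l2_fun) :
  \pi_L2 f = \pi_L2 g <-> {ae mu, forall x, f x = g x}.
Proof.
have fg : (\pi_L2 f = \pi_L2 g) <-> (f - g \in l2_null).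
  by rewrite Quotient.idealrBE; split => [/eqP|/eqP].
rewrite fg inE; split; apply: filterS => x fx; first by apply: subr0_eq.
by transitivity (f x - g x) => //; rewrite fx subrr.
Qed.

Definition L2_scale (a : R[i]) (f : L2) : L2 := \pi_L2 (a *: repr f).

Lemma pi_L2_scale a : {morph \pi_L2 : f / a *: f >-> L2_scale a f}.
Proof.
move=> f; apply/l2_piP.
have /l2_piP := reprK (\pi_L2 f).
by apply: filterS => x fx; transitivity (a * f x) => //; rewrite -fx.
Qed.

Lemma pi_L2D : {morph \pi_L2 : f g / f + g >-> f + g}.
Proof. exact: pi_addr. Qed.

Lemma L2_scaleA a b f : L2_scale a (L2_scale b f) = L2_scale (a * b) f.
Proof.
elim/quotW: f => f.
by rewrite -(pi_L2_scale b f) -(pi_L2_scale a (b *: f)) -pi_L2_scale scalerA.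
Qed.

Lemma L2_scale1 : left_id 1 L2_scale.
Proof. by elim/quotW => f; rewrite -pi_L2_scale scale1r. Qed.

Lemma L2_scaleDr : right_distributive L2_scale +%R.
Proof.
move=> a; elim/quotW => f; elim/quotW => g.
by rewrite -pi_L2D -(pi_L2_scale a f) -(pi_L2_scale a g) -pi_L2_scale -pi_L2D
  scalerDr.
Qed.

Lemma L2_scaleDl f : {morph L2_scale^~ f : a b / a + b}.
Proof.
elim/quotW: f => f a b.
by rewrite -(pi_L2_scale a f) -(pi_L2_scale b f) -pi_L2_scale -pi_L2D scalerDl.
Qed.

HB.instance Definition _ := GRing.Zmodule_isLmodule.Build R[i] L2
  L2_scaleA L2_scale1 L2_scaleDr L2_scaleDl.

Lemma pi_L2Z a : {morph \pi_L2 : f / a *: f >-> a *: f}.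
Proof. exact: pi_L2_scale. Qed.

(* Independent of the representative: see L2_norm_pi. *)
Definition L2_norm (f : L2) : R :=
  Num.sqrt (\int[mu]_x normc (repr f x) ^+ 2).

Lemma L2_norm_pi (f : l2_fun) :
  L2_norm (\pi_L2 f) = Num.sqrt (\int[mu]_x normc (f x) ^+ 2).
Proof.
have mP (h : l2_fun) : measurable_fun [set: T] (fun x => (normc (h x) ^+ 2)%:E).
  have := l2_fun_valP h; rewrite inE => -[mh _].
  exact/measurable_EFinP/measurable_cfun_normc_sq.
congr (Num.sqrt (fine _)); apply: ae_eq_integral => //.
have /l2_piP := reprK (\pi_L2 f).
by apply: filterS => x fx _; rewrite fx.
Qed.

End complex_square_integrable.

Section fourier.
Context (R : realType) (d : nat).
Local Notation T := (d.-tuple (measurableTypeR R)).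
Local Notation mu := (torus_measure R d).

Definition torus_dot (k : d.-tuple int) (x : T) : R :=
  \sum_(j < d) (tnth k j)%:~R * tnth x j.

(* exp(i t) *)
Definition expi (t : R) : R[i] := cos t +i* sin t.

Definition cintegral (f : T -> R[i]) : R[i] :=
  (\int[mu]_x Re (f x)) +i* (\int[mu]_x Im (f x)).

Definition fourier_fun (k : d.-tuple int) (f : T -> R[i]) : R[i] :=
  ((2 * pi) `^ (- (d%:R / 2)))%:C *
  cintegral (fun x => f x * expi (- torus_dot k x)).

Local Notation L2_torus := (L2 mu).

(* Independent of the representative: see fourier_coef_pi. *)
Definition fourier_coef (k : d.-tuple int) (f : L2_torus) : R[i] :=
  fourier_fun k (repr f).

Lemma measurable_expi k :
  measurable_fun [set: T] (fun x => cos (- torus_dot k x) : R) /\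
  measurable_fun [set: T] (fun x => sin (- torus_dot k x) : R).
Proof.
have mk : measurable_fun [set: T] (fun x => - torus_dot k x : R).
  apply: measurable_funN; apply: measurable_sum => j.
  by apply: measurable_funM => //; exact: measurable_tnth.
split.
- apply: (@measurableT_comp _ _ _ _ _ _ cos) => //.
  by apply: continuous_measurable_fun; exact: continuous_cos.
- apply: (@measurableT_comp _ _ _ _ _ _ sin) => //.
  by apply: continuous_measurable_fun; exact: continuous_sin.
Qed.

Lemma l2_fun_expi_integrable k (f : T -> R[i]) : f \in l2_pred mu ->
  mu.-integrable [set: T] (EFin \o (fun x => Re (f x * expi (- torus_dot k x))))
  /\
  mu.-integrable [set: T] (EFin \o (fun x => Im (f x * expi (- torus_dot k x)))).
Proof.
rewrite inE => -[[mr mi] ffin]; have [mc ms] := measurable_expi k.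
have int1 : mu.-integrable [set: T]
    (fun x => (1 + normc (f x) ^+ 2)%:E).
  apply: (@integrableD _ _ _ mu setT measurableT (cst 1%:E)
           (fun x => (normc (f x) ^+ 2)%:E)).
    exact: finite_measure_integrable_cst.
  apply/integrableP; split.
    exact/measurable_EFinP/measurable_cfun_normc_sq.
  rewrite (eq_integral (fun x => (normc (f x) ^+ 2)%:E))// => x _.
  by rewrite /= ger0_norm// sqr_ge0.
have le1 (y t : R) (z : R[i]) :
    y ^+ 2 <= normc (z * expi t) ^+ 2 -> `|y| <= 1 + normc z ^+ 2.
  rewrite normcM exprMn [X in _ * X]normc_sqE /= cos2Dsin2 mulr1 => yz.
  apply: le_trans (lerD (lexx 1) yz).
  rewrite -(real_normK (num_real y)); have := sqr_ge0 (`|y| - 1).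
  by have := normr_ge0 y; nra.
split.
- apply: le_integrable int1 => //.
    apply/measurable_EFinP.
    rewrite (_ : (fun _ => _) = (fun x => (Re \o f) x * cos (- torus_dot k x) -
       (Im \o f) x * sin (- torus_dot k x))).
      by apply: measurable_funB; apply: measurable_funM.
    by apply/funext => x /=; case: (f x).
  move=> x _ /=; rewrite lee_fin [leRHS]ger0_norm ?addr_ge0 ?sqr_ge0//.
  apply: (@le1 _ (- torus_dot k x)).
  by rewrite normc_sqE lerDl sqr_ge0.
- apply: le_integrable int1 => //.
    apply/measurable_EFinP.
    rewrite (_ : (fun _ => _) = (fun x => (Re \o f) x * sin (- torus_dot k x) +
       (Im \o f) x * cos (- torus_dot k x))).
      by apply: measurable_funD; apply: measurable_funM.
    by apply/funext => x /=; case: (f x).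
  move=> x _ /=; rewrite lee_fin [leRHS]ger0_norm ?addr_ge0 ?sqr_ge0//.
  apply: (@le1 _ (- torus_dot k x)).
  by rewrite normc_sqE lerDr sqr_ge0.
Qed.

Lemma fourier_coef_pi k (f : l2_fun mu) :
  fourier_coef k (\pi_(L2 mu) f) = fourier_fun k f.
Proof.
have [pr pi'] := l2_fun_expi_integrable k (l2_fun_valP (repr (\pi_(L2 mu) f))).
have [fr fi] := l2_fun_expi_integrable k (l2_fun_valP f).
have /l2_piP E := reprK (\pi_(L2 mu) f).
congr (_ * (fine _ +i* fine _)); apply: ae_eq_integral => //.
- exact: measurable_int pr.
- exact: measurable_int fr.
- by apply: filterS E => x E _; rewrite E.
- exact: measurable_int pi'.
- exact: measurable_int fi.
- by apply: filterS E => x E _; rewrite E.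
Qed.

Lemma fourier_funZD k a (f g : T -> R[i]) :
  f \in l2_pred mu -> g \in l2_pred mu ->
  fourier_fun k (a *: f + g) = a * fourier_fun k f + fourier_fun k g.
Proof.
move=> /(l2_fun_expi_integrable k)[fr fi] /(l2_fun_expi_integrable k)[gr gi].
have iZ (b : R) (h : T -> R) : mu.-integrable setT (EFin \o h) ->
    mu.-integrable setT (EFin \o (fun x => b * h x)).
  by move=> ih; exact: (integrableZl measurableT b ih).
rewrite mulrCA -mulrDr; congr (_ * _).
set e := fun x : T => expi (- torus_dot k x).
have E x : (a *: f + g) x * e x = a * (f x * e x) + g x * e x.
  by transitivity ((a * f x + g x) * e x) => //; rewrite mulrDl mulrA.
apply/eqP; rewrite eq_complex; apply/andP; split; apply/eqP.
- rewrite ReZD /= -!RintegralZl// -RintegralB//; try exact: iZ.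
  rewrite -RintegralD//.
    by apply: eq_Rintegral => x _; rewrite E ReZD.
  exact: (integrableB measurableT (iZ _ _ fr) (iZ _ _ fi)).
- rewrite ImZD /= -!RintegralZl// -RintegralD//; try exact: iZ.
  rewrite -RintegralD//.
    by apply: eq_Rintegral => x _; rewrite E ImZD.
  exact: (integrableD measurableT (iZ _ _ fi) (iZ _ _ fr)).
Qed.

Lemma fourier_coefZD k a (f g : L2_torus) :
  fourier_coef k (a *: f + g) = a * fourier_coef k f + fourier_coef k g.
Proof.
elim/quotW: f => f; elim/quotW: g => g.
rewrite -pi_L2Z -pi_L2D !fourier_coef_pi.
exact: fourier_funZD (l2_fun_valP f) (l2_fun_valP g).
Qed.

Definition mix_weight (s : R) (k : d.-tuple int) : R :=
  \prod_(j < d) (1 + `|tnth k j|%:~R) `^ (2 * s).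

Definition mix_sqnorm (s : R) (f : L2_torus) : \bar R :=
  \esum_(k in [set: d.-tuple int])
    (normc (fourier_coef k f) ^+ 2 * mix_weight s k)%:E.

Lemma mix_weight_ge0 s k : 0 <= mix_weight s k.
Proof. by apply: prodr_ge0 => j _; exact: powR_ge0. Qed.

Variable s : R.

Definition Hmix_pred : {pred L2_torus} :=
  mem [set f : L2_torus | (mix_sqnorm s f < +oo)%E].

Lemma Hmix_submod_closed : submod_closed Hmix_pred.
Proof.
have c0 k : fourier_coef k 0 = 0.
  by have := fourier_coefZD k (-1) 0 0; rewrite scaler0 addr0 mulN1r addNr.
split.
  apply: mem_set; rewrite /= /mix_sqnorm esum1 ?ltry// => k _.
  by rewrite c0 normc0 expr0n mul0r.
move=> a f g /set_mem/= fs /set_mem/= gs; apply: mem_set => /=.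
have esumZ (c : R) (u : d.-tuple int -> R) : 0 <= c -> (forall k, 0 <= u k) ->
    (\esum_(k in [set: d.-tuple int]) (c * u k)%:E <=
     c%:E * \esum_(k in [set: d.-tuple int]) (u k)%:E)%E.
  move=> c0' u0; apply: ge_ereal_sup => _ [X [finX _] <-].
  rewrite (eq_fsbigr (fun k => c%:E * (u k)%:E)%E)//.
  rewrite -ge0_mule_fsumr//.
  by apply: lee_wpmul2l => //; apply: esum_ge; exists X.
have u0 h k : 0 <= normc (fourier_coef k h) ^+ 2 * mix_weight s k.
  by rewrite mulr_ge0 ?sqr_ge0 ?mix_weight_ge0.
have a0 : 0 <= 2 * normc a ^+ 2 by rewrite mulr_ge0// sqr_ge0.
apply: (@le_lt_trans _ _ (
  \esum_(k in [set: d.-tuple int])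
    ((2 * normc a ^+ 2) * (normc (fourier_coef k f) ^+ 2 * mix_weight s k))%:E +
  \esum_(k in [set: d.-tuple int])
    (2 * (normc (fourier_coef k g) ^+ 2 * mix_weight s k))%:E)%E).
  rewrite -esumD; last 2 first.
  - by move=> k _; rewrite lee_fin mulr_ge0.
  - by move=> k _; rewrite lee_fin mulr_ge0.
  apply: le_esum => k _; rewrite -EFinD lee_fin !mulrA -mulrDl.
  apply: ler_wpM2r; first exact: mix_weight_ge0.
  rewrite fourier_coefZD (le_trans (normc_sqD _ _))//.
  by rewrite normcM exprMn !expr2 mulrDr !mulrA.
apply: lte_add_pinfty.
- by apply: le_lt_trans (esumZ _ _ _ _) (lte_mul_pinfty _ _ fs).
- by apply: le_lt_trans (esumZ _ _ _ _) (lte_mul_pinfty _ _ gs).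
Qed.

HB.instance Definition _ := GRing.isSubmodClosed.Build _ _ Hmix_pred
  Hmix_submod_closed.

Record Hmix := HMix { Hmix_val : L2_torus; Hmix_valP : Hmix_val \in Hmix_pred }.

HB.instance Definition _ := [isSub for Hmix_val].
HB.instance Definition _ := [Choice of Hmix by <:].
HB.instance Definition _ := [SubChoice_isSubLmodule of Hmix by <:].

(* Hmix is a subspace of L2, but carries its own norm. *)
Definition Hmix_norm (f : Hmix) : R := Num.sqrt (fine (mix_sqnorm s (val f))).

Definition Hmix_embedding : {linear Hmix -> L2_torus} := val.

End fourier.

Section approximation_numbers.
Context (R : realType) (X Y : lmodType R[i]).
Variables (nX : X -> R) (nY : Y -> R).

(* The two spaces are vector spaces over R[i] given together with their norms.
   op_norm is +oo exactly for the unbounded linear maps. *)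
Definition op_norm (f : X -> Y) : \bar R :=
  ereal_sup [set (nY (f x))%:E | x in [set x | nX x <= 1]].

(* The range of A has a basis of m elements; unlike \dim, this makes sense in
   spaces of infinite dimension. *)
Definition has_rank (A : X -> Y) (m : nat) : Prop :=
  exists e : 'I_m -> Y,
  [/\ forall i, range A (e i),
      forall c : 'I_m -> R[i], \sum_i c i *: e i = 0 -> forall i, c i = 0
    & forall x, exists c : 'I_m -> R[i], A x = \sum_i c i *: e i].

Definition approx_number (F : {linear X -> Y}) (n : nat) : \bar R :=
  ereal_inf [set op_norm (fun x => F x - A x) | A in
    [set A : {linear X -> Y} |
      (op_norm A < +oo)%E /\ exists2 m, (m < n)%N & has_rank A m]].

End approximation_numbers.

(* Main.v *)
(* Put e_k(x) = (2 pi)^(-d/2) e^{ikx} and W(k) = prod_j (1 + |k_j|).  In the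
   orthonormal basis (e_k) of L_2 the embedding is diagonal with entries
   W(k)^(-s).  Let C_d(x) be the number of k with W(k) <= x.  If C_d(x) < n, then
   truncating the Fourier series to this hyperbolic cross has rank < n and error
   at most x^(-s).  If C_d(x) >= n, then an operator of rank < n kills some
   nonzero trigonometric polynomial with frequencies in the cross, whose L_2 norm
   is at least x^(-s) times its mixed norm.

   C_d is estimated from C_{d+1}(x) = C_d(x) + 2 sum_{l >= 2} C_d(x / l) by
   telescoping with 1/(l+1) <= ln (l+1) - ln l <= 1/l.

   Completeness of (e_k): the bounded measurable functions lying in the L_2
   closure of the trigonometric polynomials form an algebra closed under bounded
   pointwise limits.  Iterating the polynomial 3u^2 - 2u^3 turns f in this algebra
   into the indicator of {f > a}, so the sets with indicator in the algebra form
   a sigma-algebra, which contains the coordinate rays because these are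
   described, up to null sets, by the signs of sin x_j and of cos x_j - cos a. *)
From HB Require Import structures.
Require Import Defs.
From mathcomp Require Import all_boot all_order all_algebra.
From mathcomp Require Import finmap generic_quotient ring_quotient.
From mathcomp Require Import all_classical all_reals all_analysis.
From mathcomp Require Import measurable_realfun.
From mathcomp Require Import complex ring lra zify.

Set Implicit Arguments.
Unset Strict Implicit.
Unset Printing Implicit Defensive.

Import Order.TTheory GRing.Theory Num.Theory.
Import numFieldNormedType.Exports.
Import ComplexField.Normc.
Local Open Scope ring_scope.

(** * Counting points of hyperbolic crosses *)

Section counting.
Context (R : realType).
Implicit Types (r x y L : R) (d m n : nat).

(** An explicit list, so that [size] counts it and sums can range over it. [Negz l] is [-(l + 1)],
    so the negative range is one too long: its last entry has weight above [r] and contributes an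
    empty slice. *)
Fixpoint hyperbolic_cross d r : seq (d.-tuple int) :=
  if d is d'.+1 then
    [seq cons_tuple k t | k <- map Posz (iota 0 (Num.truncn r)) ++
                                  map Negz (iota 0 (Num.truncn r)),
                             t <- hyperbolic_cross d' (r / (1 + `|k|%:~R))]
  else if 1 <= r then [:: [tuple]] else [::].

Lemma hyperbolic_cross_uniq d r : uniq (hyperbolic_cross d r).
Proof.
elim: d r => [|d IH] r /=; first by case: ifP.
apply: allpairs_uniq_dep => //.
- rewrite cat_uniq !map_inj_uniq ?iota_uniq ?andbT//=; last by move=> ? ? [].
    by apply/hasPn => _ /mapP[k _ ->]; apply/negP => /mapP[].
  by move=> ? ? [].
- by move=> [k t] [k' t'] _ _ /= [] -> /val_inj ->.
Qed.

Lemma mem_hyperbolic_cross d r (k : d.-tuple int) :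
  (k \in hyperbolic_cross d r) = (\prod_(j < d) (1 + `|tnth k j|%:~R) <= r).
Proof.
elim: d r k => [|d IH] r k /=.
  by rewrite big_ord0 (tuple0 k); case: ifP => _; rewrite inE.
have nk1 (i : int) : 1 <= 1 + `|i|%:~R :> R by rewrite lerDl ler0z.
have nk (i : int) : 0 < 1 + `|i|%:~R :> R by apply: lt_le_trans (nk1 i).
have prod1 d' (t : d'.-tuple int) : 1 <= \prod_(j < d') (1 + `|tnth t j|%:~R) :> R.
  by apply: (big_ind (fun x => 1 <= x)) => // x y x1 y1; rewrite mulr_ege1.
case/tupleP: k => a t; rewrite big_ord_recl tnth0.
under eq_bigr do rewrite tnthS.
apply/allpairsPdep/idP => [[k' [t' [_ + E]]]|le_r].
  have [-> /val_inj ->] := congr1 val E.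
  by rewrite IH ler_pdivlMr// mulrC.
exists a, t; split => //; last by rewrite IH ler_pdivlMr// mulrC.
(* The other factors are at least 1, so the first factor alone is at most [r], which puts [a] in the
   enumerated range. *)
have ar : 1 + `|a|%:~R <= r.
  by apply: le_trans le_r; rewrite ler_pMr.
have key (l : nat) : (1 + l%:R <= r) -> (l < Num.truncn r)%N.
  by move=> lr; rewrite truncn_gt_nat -natr1 addrC.
rewrite mem_cat; case: a ar {le_r} => l /= lr.
  by rewrite map_f// mem_iota key.
rewrite [X in _ || X]map_f ?orbT// mem_iota /= key// (le_trans _ lr)// lerD2l.
by rewrite NegzE normrN -pmulrn ler_nat.
Qed.

Definition cross_count d r : nat := size (hyperbolic_cross d r).

Lemma cross_count0 r : cross_count 0 r = (1 <= r) :> nat.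
Proof. by rewrite /cross_count /=; case: ifP. Qed.

(** Slicing by the first coordinate: the index [l] collects the slices at [l] and at [-(l + 1)], of
    weights [l + 1] and [l + 2]. *)
Lemma cross_countS d r : cross_count d.+1 r =
  (\sum_(0 <= l < Num.truncn r)
    (cross_count d (r / l.+1%:R) + cross_count d (r / l.+2%:R)))%N.
Proof.
rewrite /cross_count /= size_allpairs_dep map_cat sumn_cat -!map_comp.
rewrite !sumnE !big_map big_split /index_iota subn0; congr (_ + _)%N.
by apply: eq_bigr => l _ /=; rewrite -natr1 addrC.
Qed.

Lemma cross_count_lt1 d r : r < 1 -> cross_count d r = 0%N.
Proof.
case: d => [|d] r1; first by rewrite cross_count0 leNgt r1.
by rewrite cross_countS (truncn0Pn _ _) ?big_geq// -ltNge.
Qed.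


(** The difference factors as [x - y] times [n + 1] monomials of degree [n], each lying between
    [y ^ n] and [x ^ n]. *)
Lemma subrX_bounds x y n : 0 <= y -> y <= x ->
  n.+1%:R * y ^+ n * (x - y) <= x ^+ n.+1 - y ^+ n.+1
    <= n.+1%:R * x ^+ n * (x - y).
Proof.
move=> y0 yx; have x0 := le_trans y0 yx; have xy0 : 0 <= x - y by rewrite subr_ge0.
rewrite subrXX ![_ * (x - y)]mulrC; apply/andP; split; apply: ler_wpM2l => //.
- rewrite mulr_natl (_ : y ^+ n *+ n.+1 = \sum_(i < n.+1) y ^+ n);
    last by rewrite sumr_const card_ord.
  apply: ler_sum => i _.
  rewrite -[in leLHS](subnK (leq_ord i)) exprD ler_wpM2r ?exprn_ge0//.
  by rewrite lerXn2r ?nnegrE.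
- rewrite mulr_natl (_ : x ^+ n *+ n.+1 = \sum_(i < n.+1) x ^+ n);
    last by rewrite sumr_const card_ord.
  apply: ler_sum => i _.
  rewrite -[in leRHS](subnK (leq_ord i)) exprD ler_wpM2l ?exprn_ge0//.
  by rewrite lerXn2r ?nnegrE.
Qed.

(** Both sides are [ln (1 + u) <= u], at [u = - 1 / (m + 2)] and at [u = 1 / (m + 1)]. *)
Lemma ln_succ_bounds m :
  m.+2%:R^-1 <= ln (m.+2%:R : R) - ln m.+1%:R <= m.+1%:R^-1.
Proof.
have p1 : 0 < m.+1%:R :> R by rewrite ltr0n.
have p2 : 0 < m.+2%:R :> R by rewrite ltr0n.
rewrite -ln_div ?posrE//; apply/andP; split.
- rewrite -invf_div lnV ?posrE ?divr_gt0// lerNr.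
  rewrite (_ : m.+1%:R / m.+2%:R = 1 + - m.+2%:R^-1); last first.
    by rewrite -[m.+2%:R]natr1 in p2 *; field; rewrite gt_eqF.
  by rewrite le_ln1Dx// ltrN2 invf_lt1// ltr1n.
- rewrite (_ : m.+2%:R / m.+1%:R = 1 + m.+1%:R^-1); last first.
    by rewrite -[m.+2%:R]natr1; field; rewrite gt_eqF.
  by rewrite le_ln1Dx// (lt_trans _ (_ : 0 < _)) ?invr_gt0.
Qed.

(** Comparison with the integral of [(L - ln t) ^ n / t], whose antiderivative is
    [- (L - ln t) ^ (n + 1) / (n + 1)]: each summand is at most the increment over the interval that
    ends at its point. *)
Lemma sum_ln_le L n m : ln m.+1%:R <= L ->
  \sum_(1 <= l < m.+1) l.+1%:R^-1 * (L - ln l.+1%:R) ^+ n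
  <= (L ^+ n.+1 - (L - ln m.+1%:R) ^+ n.+1) / n.+1%:R.
Proof.
elim: m => [|m IH] mL; first by rewrite big_geq// ln1 subr0 subrr mul0r.
have /andP[h1 h2] := ln_succ_bounds m.
have hm : ln m.+1%:R <= L by apply: le_trans mL; rewrite ler_ln ?posrE ?ltr0n// ler_nat.
rewrite big_nat_recr//=; apply: le_trans (lerD (IH hm) (lexx _)) _.
have y0 : 0 <= L - ln m.+2%:R by rewrite subr_ge0.
have yx : L - ln m.+2%:R <= L - ln m.+1%:R.
  by rewrite lerD2l lerN2 ler_ln ?posrE ?ltr0n// ler_nat.
have /andP[B _] := subrX_bounds n y0 yx.
have n0 : 0 < n.+1%:R :> R by rewrite ltr0n.
rewrite -lerBrDl -mulrBl ler_pdivlMr//.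
rewrite (_ : _ - _ - _ = (L - ln m.+1%:R) ^+ n.+1 - (L - ln m.+2%:R) ^+ n.+1); last by ring.
apply: le_trans B; 
rewrite [leLHS](_ : _ = n.+1%:R * (L - ln m.+2%:R) ^+ n * m.+2%:R^-1);
  last by ring.
apply: ler_wpM2l; first by rewrite mulr_ge0 ?exprn_ge0.
by rewrite (_ : _ - (_ - _) = ln m.+2%:R - ln m.+1%:R)//; ring.
Qed.

(** The reverse comparison uses the interval that starts at each point, so the last increment ends
    at [m + 1], where [L - ln (m + 1)] may be negative; hence the maximum with 0. *)
Lemma sum_ln_ge L n m : ln 2 <= L -> (forall l, (l.+1 <= m)%N -> ln l.+1%:R <= L) ->
  ((L - ln 2) ^+ n.+1 - Num.max 0 (L - ln m.+1%:R) ^+ n.+1) / n.+1%:R <=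
  \sum_(1 <= l < m) l.+1%:R^-1 * (L - ln l.+1%:R) ^+ n.
Proof.
move=> L2; elim: m => [|m IH] mL.
  rewrite big_geq// ln1 subr0 mulr_le0_ge0 ?invr_ge0// subr_le0.
  have L0 : 0 <= L by apply: le_trans L2; rewrite ln_ge0// ler1n.
  by rewrite (max_idPr L0) lerXn2r ?nnegrE ?subr_ge0// gerBl ln_ge0// ler1n.
case: m IH mL => [|m] IH mL.
  by rewrite big_geq// (max_idPr _) ?subr_ge0// subrr mul0r.
have /andP[h1 h2] := ln_succ_bounds m.+1.
rewrite big_nat_recr//=; apply: le_trans (lerD (IH _) (lexx _)); last first.
  by move=> l lm; apply: mL; rewrite ltnW.
have n0 : 0 < n.+1%:R :> R by rewrite ltr0n.
have x0 : 0 <= L - ln m.+2%:R by rewrite subr_ge0 mL.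
rewrite (max_idPr x0) -lerBlDl -mulrBl ler_pdivrMr//.
set y := Num.max 0 _; set x := L - ln m.+2%:R in x0 *.
have y0 : 0 <= y by rewrite le_max lexx.
have yx : y <= x.
  rewrite ge_max x0 lerD2l lerN2 ler_ln ?posrE ?ltr0n//= ?ler_nat//.
have /andP[_ B] := subrX_bounds n y0 yx.
rewrite (_ : _ - _ - _ = x ^+ n.+1 - y ^+ n.+1); last by ring.
apply: le_trans B _; rewrite [leRHS](_ : _ = n.+1%:R * x ^+ n * m.+2%:R^-1); last by ring.
rewrite ler_wpM2l ?mulr_ge0 ?exprn_ge0//.
have : L - ln m.+3%:R <= y by rewrite le_max lexx orbT.
set a := _^-1 in h2 *; set b := ln m.+3%:R in h1 h2 *; rewrite /x => ?; lra.
Qed.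


(** With [M] the integer part of [r], the admissible integers are those of absolute value below [M];
    zero is counted once, and the truncated predecessor also covers [M = 0]. *)
Lemma cross_count1 r : cross_count 1 r = ((Num.truncn r).*2).-1.
Proof.
rewrite cross_countS; set M := Num.truncn r.
rewrite (eq_big_nat _ _ (F2 := fun l => (1 + (l.+1 < M))%N)); last first.
  move=> l /andP[_ lM]; rewrite !cross_count0.
  rewrite !ler_pdivlMr ?ltr0n// !mul1r -truncn_gt_nat lM /M truncn_gt_nat.
  by [].
rewrite big_split/= sum_nat_const_nat subn0 muln1.
case: M => [|m]; first by rewrite big_geq.
rewrite big_nat_recr//= ltnn addn0 (eq_big_nat _ _ (F2 := fun=> 1%N)).
  by rewrite sum_nat_const_nat; lia.
by move=> l /andP[_ lm]; rewrite ltnS lm.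
Qed.

(* Growing the shift d / 2 by 1 / 2 at each step absorbs, by Bernoulli's
   inequality, the term l = 1, which the telescoping does not cover. *)
Lemma cross_count_ub d r : 1 <= r ->
  (cross_count d.+1 r)%:R <=
    2 ^+ d.+1 * r * (ln r + d%:R / 2) ^+ d / d`!%:R :> R.
Proof.
elim: d r => [|d IH] r r1; have r0 := lt_le_trans ltr01 r1.
  rewrite cross_count1 expr0 mulr1 divr1.
  apply: (@le_trans _ _ (2 * (Num.truncn r)%:R)).
    by rewrite -natrM ler_nat; lia.
  by rewrite ler_pM2l// truncn_le ltW.
rewrite cross_countS big_split natrD !natr_sum.
set M := Num.truncn r; pose L := ln r + d%:R / 2.
pose K : R := 2 ^+ d.+1 * r / d`!%:R.
have K0 : 0 <= K by rewrite !mulr_ge0 ?exprn_ge0 ?invr_ge0// ltW.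
pose g l := l.+1%:R^-1 * (L - ln l.+1%:R) ^+ d.
have term l : (l < M)%N -> (cross_count d.+1 (r / l.+1%:R))%:R <= K * g l.
  rewrite truncn_gt_nat => lr; have l0 : 0 < l.+1%:R :> R by rewrite ltr0n.
  apply: le_trans (IH _ _) _; first by rewrite ler_pdivlMr// mul1r.
  rewrite ln_div ?posrE// /K /g /L le_eqVlt; apply/orP; left; apply/eqP.
  rewrite (_ : ln r + _ - _ = ln r - ln l.+1%:R + d%:R / 2); last by ring.
  by ring.
have M0 : (0 < M)%N by rewrite truncn_gt0.
case EM : M M0 => [//|m] _.
have lnm : ln m.+1%:R <= L.
  rewrite /L ler_wpDr ?divr_ge0// ler_ln ?posrE ?ltr0n//.
  by rewrite -truncn_gt_nat -/M EM.
have L0 : 0 <= L by apply: le_trans lnm; rewrite ln_ge0// ler1n.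
have S1 : \sum_(0 <= l < m.+1) (cross_count d.+1 (r / l.+1%:R))%:R <=
    K * (L ^+ d + \sum_(1 <= l < m.+1) g l).
  rewrite big_ltn// mulrDr lerD//.
    by apply: le_trans (term _ _) _; rewrite ?EM// /g invr1 mul1r ln1 subr0.
  rewrite mulr_sumr; apply: ler_sum_nat => l /andP[_ lm]; apply: term.
  by rewrite EM.
(* The negative slices start at weight 2, and the last one is empty because [r < m + 2]. *)
have S2 : \sum_(0 <= l < m.+1) (cross_count d.+1 (r / l.+2%:R))%:R <=
    K * (\sum_(1 <= l < m.+1) g l).
  rewrite big_nat_recr//= [X in _ + X](_ : _ = 0) ?addr0; last first.
    by rewrite cross_count_lt1// ltr_pdivrMr ?ltr0n// mul1r -EM truncnS_gt.
  rewrite big_add1/= mulr_sumr; apply: ler_sum_nat => l /andP[_ lm]; apply: term.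
  by rewrite EM.
apply: le_trans (lerD S1 S2) _.
have {S1 S2} S := sum_ln_le d lnm.
have {}S : \sum_(1 <= l < m.+1) g l <= L ^+ d.+1 / d.+1%:R.
  apply: le_trans S _; rewrite ler_pM2r ?invr_gt0 ?ltr0n// lerBlDr lerDl.
  by rewrite exprn_ge0// subr_ge0.
rewrite -mulrDr.
(* Half of [(d + 1) * L ^ d] is at most the growth of the power from [L] to [L + 1 / 2]; this pays
   for the summand [L ^ d] of [S1]. *)
have /andP[B _] : d.+1%:R * L ^+ d * (L + 2^-1 - L) <=
    (L + 2^-1) ^+ d.+1 - L ^+ d.+1 <= d.+1%:R * (L + 2^-1) ^+ d * (L + 2^-1 - L).
  by apply: subrX_bounds => //; lra.
rewrite (_ : ln r + _ = L + 2^-1); last by rewrite /L -natr1; field.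
have d0 : 0 < d.+1%:R :> R by rewrite ltr0n.
rewrite [leRHS](_ : _ = K * (2 / d.+1%:R * (L + 2^-1) ^+ d.+1)); last first.
  rewrite /K factS natrM exprS; field.
  by rewrite nat1r !pnatr_eq0 -!lt0n fact_gt0.
apply: ler_wpM2l => //; set s := \sum_(_ <= _ < _) _ in S *.
apply: (@le_trans _ _ (L ^+ d + 2 * (L ^+ d.+1 / d.+1%:R))).
  by move: S; set q := _ / _; lra.
rewrite [leRHS]mulrAC ler_pdivlMr// mulrDl -mulrA divfK ?gt_eqF//.
by move: B; set a := L ^+ d; set b := L ^+ _; set c := (_ + _) ^+ _; lra.
Qed.

(* The term l = 1 is dropped, so that the sums start at l = 2: this is the shift
   by ln 2 at each step. *)
Lemma cross_count_lb d r : 2 ^+ d.+1 <= r ->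
  2 ^+ d * r * (ln r - d.+1%:R * ln 2) ^+ d / d`!%:R
    <= (cross_count d.+1 r)%:R :> R.
Proof.
elim: d r => [|d IH] r rd; have r0 : 0 < r by apply: lt_le_trans rd; rewrite exprn_gt0.
  rewrite cross_count1 !expr0 mul1r mulr1 divr1; set M := Num.truncn r.
  (* From [M >= 2] follows [2 * M - 1 >= M + 1 > r]. *)
  have M2 : (1 < M)%N by rewrite truncn_gt_nat.
  by apply: le_trans (ltW (truncnS_gt r)) _; rewrite ler_nat -/M; lia.
rewrite cross_countS big_split [in leRHS]natrD !natr_sum.
set M := Num.truncn r; pose L := ln r - d.+1%:R * ln 2.
pose K : R := 2 ^+ d * r / d`!%:R.
have K0 : 0 <= K by rewrite !mulr_ge0 ?exprn_ge0 ?invr_ge0// ltW.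
pose g l := l.+1%:R^-1 * (L - ln l.+1%:R) ^+ d.
have e0 : 0 < 2 ^+ d.+1 :> R by rewrite exprn_gt0.
(* The induction hypothesis applies to [r / l] exactly for [l] up to [m]; the other slices are
   bounded below by 0. *)
pose m := Num.truncn (r / 2 ^+ d.+1).
have lm l : (l < m)%N -> 2 ^+ d.+1 <= r / l.+1%:R.
  by rewrite truncn_gt_nat ler_pdivlMr// ler_pdivlMr ?ltr0n// mulrC.
have mM : (m <= M)%N.
  by apply: le_truncn; rewrite ler_pdivrMr// ler_peMr ?(ltW r0)// exprn_ege1// ler1n.
have LE l : (0 < l)%N -> ln (r / l%:R) - d.+1%:R * ln 2 = L - ln l%:R.
  by move=> l0; rewrite ln_div ?posrE ?ltr0n// /L; ring.
have term l : (l < m)%N -> K * g l <= (cross_count d.+1 (r / l.+1%:R))%:R.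
  move=> /lm lr; apply: le_trans (IH _ lr).
  by rewrite LE// /K /g le_eqVlt; apply/orP; left; apply/eqP; ring.
have S1 : K * (\sum_(1 <= l < m) g l) <=
    \sum_(0 <= l < M) (cross_count d.+1 (r / l.+1%:R))%:R.
  have [->|m0] := posnP m; first by rewrite big_geq// mulr0 sumr_ge0.
  rewrite (big_cat_nat (leq0n m) mM)//= [in leRHS]big_ltn//.
  rewrite -addrA ler_wpDl// ler_wpDr ?sumr_ge0//.
  by rewrite mulr_sumr; apply: ler_sum_nat => l /andP[_ ?]; apply: term.
have S2 : K * (\sum_(1 <= l < m) g l) <=
    \sum_(0 <= l < M) (cross_count d.+1 (r / l.+2%:R))%:R.
  rewrite (big_cat_nat (leq0n m.-1) (leq_trans (leq_pred m) mM))//= ler_wpDr ?sumr_ge0//.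
  rewrite big_add1 mulr_sumr; apply: ler_sum_nat => l /andP[_ lm1]; apply: term.
  by move: lm1; case: (m).
apply: le_trans (lerD S1 S2).
have ln2L : ln 2 <= L.
  rewrite /L lerBrDr addrC -[X in _ + X <= _]mul1r -mulrDl natr1.
  by rewrite mulr_natl -lnXn// ler_ln ?posrE ?exprn_gt0.
have lnL l : (l.+1 <= m)%N -> ln l.+1%:R <= L.
  move=> /lm lr; rewrite -subr_ge0 -LE// subr_ge0 mulr_natl -lnXn//.
  by rewrite ler_ln ?posrE// divr_gt0// ltr0n.
have := sum_ln_ge d ln2L lnL.
(* By the choice of [m], [r / (m + 1) < 2 ^ (d + 1)], that is [L - ln (m + 1) <= 0], so the boundary
   term of the telescoped sum vanishes. *)
rewrite (max_idPl _) ?expr0n/= ?subr0; last first.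
  rewrite -LE// subr_le0 mulr_natl -lnXn// ler_ln ?posrE ?divr_gt0 ?ltr0n//.
  by rewrite ler_pdivrMr ?ltr0n// mulrC -ler_pdivrMr// ltW// truncnS_gt.
rewrite -mulrDr -/g => S.
rewrite (_ : ln r - _ = L - ln 2); last by rewrite /L -[d.+2%:R]natr1; ring.
rewrite [leLHS](_ : _ = K * (2 * ((L - ln 2) ^+ d.+1 / d.+1%:R))); last first.
  rewrite /K factS natrM exprS; field.
  by rewrite nat1r !pnatr_eq0 -!lt0n fact_gt0.
by apply: ler_wpM2l => //; move: S; set q := _ / _; lra.
Qed.

End counting.

(** * Inverting the counting bounds: from the radius of the cross to the index [n] *)

Section numeric.
Context (R : realType).
Implicit Types (r x y L s : R) (d m n : nat).

Lemma ln_ge1BV x : 0 < x -> 1 - x^-1 <= ln x.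
Proof.
move=> x0; have := @le_ln1Dx R (x^-1 - 1).
rewrite [1 + _]addrC subrK lnV ?posrE// ltrBrDr addNr invr_gt0 => /(_ x0).
lra.
Qed.

Lemma lnX n x : 0 < x -> ln (x ^+ n) = n%:R * ln x.
Proof. by move=> x0; rewrite lnXn// mulr_natl. Qed.

Lemma ln2_ge : 1 / 2 <= ln 2 :> R.
Proof. by apply: le_trans (ln_ge1BV _); lra. Qed.

Lemma ln3_ge : 2 / 3 <= ln 3 :> R.
Proof. by apply: le_trans (ln_ge1BV _); lra. Qed.

Lemma ln12E : ln 12 = 2 * ln 2 + ln 3 :> R.
Proof.
have -> : 12 = 2 ^+ 2 * 3 :> R by lra.
by rewrite lnM ?posrE// lnXn// mulr2n; lra.
Qed.

(** Weak Stirling bound [d! >= (d / e) ^ d]. The induction step amounts to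
    [d * (ln (d + 1) - ln d) <= 1]. *)
Lemma ln_fact_ge d : d%:R * ln d%:R - d%:R <= ln d`!%:R :> R.
Proof.
elim: d => [|d IH]; first by rewrite mul0r subr0 fact0 ln1.
rewrite factS natrM lnM ?posrE ?ltr0n ?fact_gt0//.
suff : d.+1%:R * ln d.+1%:R - d.+1%:R - ln d.+1%:R <= d%:R * ln d%:R - d%:R :> R.
  by move: IH; lra.
case: d {IH} => [|d]; first by rewrite ln1; lra.
have /andP[_] := @ln_succ_bounds R d.
rewrite -(ler_pM2l (_ : 0 < d.+1%:R)) ?ltr0n// divff ?pnatr_eq0// mulrBr.
rewrite -[d.+2%:R as X in X * _ - X - _]natr1.
by set a := ln _; set b := ln _; set c := d.+1%:R; lra.
Qed.

(** Collects the rate into a single power [y ^ s]; then [y^-1] serves as the radius of the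
    hyperbolic cross. *)
Lemma powR_rate d n s (A : R) : 0 <= A -> 1 <= ln n%:R :> R ->
  (A `^ s * (ln n%:R `^ (d%:R * s) / n%:R `^ s)) =
  (A * ln n%:R ^+ d / n%:R) `^ s :> R.
Proof.
move=> A0 n1; have l0 : 0 <= ln n%:R :> R by apply: le_trans n1.
rewrite powRM ?mulr_ge0 ?exprn_ge0 ?invr_ge0// powRM ?exprn_ge0// -mulrA.
congr (_ * (_ * _)); first by rewrite -powR_mulrn// -powRrM.
by rewrite -[in RHS]powR_inv1// -powRrM mulN1r powRN.
Qed.

(** At this radius [ln r + d / 2 <= ln n], so the upper count is at most [(2 / 3) ^ (d + 1) * n]. *)
Lemma cross_count_lt d n : (27 ^ d.+1 <= n)%N ->
  (cross_count d.+1 (3 ^+ d.+1 / d`!%:R * ln n%:R ^+ d / n%:R : R)^-1 < n)%N.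
Proof.
move=> dn; have n0 : (0 < n)%N by apply: leq_trans dn; rewrite expn_gt0.
have n0R : 0 < n%:R :> R by rewrite ltr0n.
have l3 := ln3_ge.
have lnn : d.+1%:R <= ln n%:R :> R.
  apply: (@le_trans _ _ (ln (27 ^ d.+1)%:R)).
    rewrite natrX lnX// ler_peMr//.
    have -> : 27 = 3 ^+ 3 :> R by lra.
    by rewrite lnX//; lra.
  by rewrite ler_ln ?posrE// ?ltr0n ?expn_gt0// ler_nat.
have ln0 : 0 < ln n%:R :> R by apply: lt_le_trans lnn; rewrite ltr0n.
have f0 : 0 < d`!%:R :> R by rewrite ltr0n fact_gt0.
set r := _^-1.
have rE : r = n%:R * d`!%:R / (3 ^+ d.+1 * ln n%:R ^+ d).
  by rewrite /r; field; rewrite !gt_eqF ?exprn_gt0.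
have r0 : 0 < r by rewrite rE divr_gt0 ?mulr_gt0 ?exprn_gt0.
have [r1|r1] := ltP r 1; first by rewrite cross_count_lt1.
rewrite -(ltr_nat R); apply: le_lt_trans (cross_count_ub d r1) _.
have fd : d`!%:R <= ln n%:R ^+ d :> R.
  apply: (@le_trans _ _ (d.+1%:R ^+ d)); last first.
    by rewrite lerXn2r ?nnegrE ?(ltW ln0).
  rewrite -natrX ler_nat; elim: (d) => // k IH; rewrite factS.
  rewrite expnS leq_mul//; apply: leq_trans IH _.
  by case: k => // k; rewrite leq_exp2r.
have rn : r <= n%:R / 3 ^+ d.+1.
  rewrite rE invfM mulrACA ler_piMr ?divr_ge0 ?exprn_ge0 ?(ltW n0R)//.
  by rewrite ler_pdivrMr ?exprn_gt0// mul1r.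
have lnr : ln r + d%:R / 2 <= ln n%:R.
  have : ln r <= ln (n%:R / 3 ^+ d.+1) by rewrite ler_ln ?posrE ?divr_gt0 ?exprn_gt0.
  rewrite ln_div ?posrE ?exprn_gt0// lnX// -natr1.
  have : 0 <= d%:R :> R by rewrite ler0n.
  by move: l3; set a := d%:R; set b := ln 3; nra.
apply: (@le_lt_trans _ _ ((2 / 3) ^+ d.+1 * n%:R)).
  rewrite [leRHS](_ : _ = 2 ^+ d.+1 * r * ln n%:R ^+ d / d`!%:R); last first.
    by rewrite rE exprMn exprVn; field; rewrite !gt_eqF ?exprn_gt0.
  rewrite ler_pM2r ?invr_gt0// ler_pM2l ?mulr_gt0 ?exprn_gt0//.
  rewrite lerXn2r ?nnegrE ?(ltW ln0)// addr_ge0 ?divr_ge0// ln_ge0//.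
by rewrite -[ltRHS]mul1r ltr_pM2r// exprn_ilt1//; lra.
Qed.

(** With [kap = 2 / (2 + ln 12)] the hypothesis on [n] reads [kap * ln n > 2 * (d + 1)]. For [d > 0]
    everything rests on [kap * N <= 2 * (ln r - D * ln 2)], which makes the lower count applicable
    and also large enough. *)
Lemma cross_count_ge d n : (12 * expR 2) ^+ d.+1 < n%:R :> R ->
  (n <= cross_count d.+1
    (3 / d.+1`!%:R * (2 / (2 + ln 12)) ^+ d.+1 * ln n%:R ^+ d / n%:R : R)^-1)%N.
Proof.
set N := ln n%:R; set kap : R := 2 / (2 + ln 12); move=> dn.
have l2 := ln2_ge; have l3 := ln3_ge; have l12 := ln12E.
have e2 : 3 <= expR 2 :> R by apply: le_trans (expR_ge1Dx _); lra.
have e0 : 0 < 12 * expR 2 :> R by rewrite mulr_gt0// expR_gt0.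
have n0 : 0 < n%:R :> R by apply: le_lt_trans dn; rewrite exprn_ge0// ltW.
have N_gt : d.+1%:R * (2 + ln 12) < N.
  have : ln ((12 * expR 2) ^+ d.+1) < N by rewrite ltr_ln ?posrE ?exprn_gt0.
  by rewrite lnX// lnM ?posrE ?expR_gt0// expRK [_ + 2]addrC.
have lam0 : 0 < 2 + ln 12 :> R by rewrite l12; lra.
have d1 : 1 <= d.+1%:R :> R by rewrite ler1n.
have N3 : 3 < N.
  by apply: le_lt_trans N_gt; move: l12; set a := d.+1%:R in d1 *; nra.
have N0 : 0 < N by lra.
have kap0 : 0 < kap by rewrite divr_gt0.
have kap_lt : kap <= 6 / 11 by rewrite ler_pdivrMr// l12; lra.
have kapE : kap * (2 + ln 12) = 2 by rewrite divfK ?gt_eqF.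
clearbody kap.
have f0 : 0 < d.+1`!%:R :> R by rewrite ltr0n fact_gt0.
set r := _^-1.
have rE : r = n%:R * d.+1`!%:R / (3 * kap ^+ d.+1 * N ^+ d).
  by rewrite /r; field; rewrite !gt_eqF ?exprn_gt0.
have r0 : 0 < r by rewrite rE divr_gt0 ?mulr_gt0 ?exprn_gt0.
case: d dn N_gt d1 f0 @r rE r0 => [|d] dn N_gt d1 f0 r rE r0.
  (* Dimension one uses the exact count: [kap <= 6 / 11] gives [r >= 11 * n / 18], and [n > 36]
     leaves room for the rounding. *)
  rewrite rE !expr1 expr0 mulr1 mulr1 in r0 *.
  have n36 : 36 < n%:R :> R by apply: le_lt_trans dn; rewrite expr1; lra.
  rewrite cross_count1; set M := Num.truncn _.
  suff : n%:R + 1 < (M.*2)%:R + 1 :> R by rewrite !natr1 ltr_nat; clear; lia.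
  have := truncnS_gt (n%:R / (3 * kap)); rewrite -/M.
  have : n%:R * (11 / 18) <= n%:R / (3 * kap).
    rewrite ler_pM2l// -[leRHS]mul1r ler_pdivlMr; lra.
  by rewrite -muln2 natrM -natr1; lra.
rewrite -(ler_nat R).
have dR : 2 <= d.+2%:R :> R by rewrite ler_nat.
set D : R := d.+2%:R in N_gt d1 dR.
(* With t = kap N / D >= 2, Stirling's d! >= (d / e)^d turns the definition of r
   into ln r >= N - D (1 + ln t). *)
pose t := kap * N / D.
have D0 : 0 < D by lra.
have t0 : 0 < t by rewrite divr_gt0// mulr_gt0.
have NE : N = D * t * (1 + ln 12 / 2).
  have -> : 1 + ln 12 / 2 = kap^-1.
    have kn0 : kap != 0 by rewrite gt_eqF.
    by apply: (mulfI kn0); rewrite divff//; lra.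
  by rewrite /t; field; rewrite !gt_eqF.
have t2 : 2 <= t.
  rewrite ler_pdivlMr// -(ler_pM2r lam0) [leRHS]mulrAC kapE.
  by move: N_gt; lra.
have lntE : ln t = ln kap + ln N - ln D.
  by rewrite /t ln_div ?lnM ?posrE ?mulr_gt0.
have tE : kap * N = D * t by rewrite /t; field; rewrite gt_eqF.
clearbody t.
(* The tangent of the logarithm at [t = 2], the smallest value that [t] can take. *)
have lnt : ln t <= t / 2 - 1 + ln 2.
  have := @le_ln1Dx R (t / 2 - 1); rewrite [1 + _]addrC subrK ln_div ?posrE//.
  by move=> H; have := H _; lra.
have lnr : N - D - D * ln t <= ln r.
  have pk : 0 < kap ^+ d.+2 by exact: exprn_gt0.
  have pN : 0 < N ^+ d.+1 by exact: exprn_gt0.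
  have p3 : 0 < 3 * kap ^+ d.+2 by exact: mulr_gt0.
  have pn : 0 < n%:R * d.+2`!%:R :> R by exact: mulr_gt0.
  have pd : 0 < 3 * kap ^+ d.+2 * N ^+ d.+1 by exact: mulr_gt0.
  rewrite rE (ln_div pn pd) (lnM n0 f0) (lnM p3 pN) (lnM _ pk) ?posrE// !lnX// -/N -/D.
  have := ln_fact_ge d.+2; rewrite -/D.
  have : ln 3 <= ln N by rewrite ler_ln ?posrE//; lra.
  rewrite lntE (_ : d.+1%:R = D - 1); last by rewrite /D -natr1; ring.
  by set a := ln _; set b := ln _; set c := ln _; set e := ln _; lra.
have key : kap * N <= 2 * (ln r - D * ln 2).
  rewrite tE.
  apply: (@le_trans _ _ (2 * (N - D - D * ln t - D * ln 2))); last by lra.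
  rewrite NE l12.
  rewrite (_ : 2 * _ =
    D * (2 * (t * (1 + (2 * ln 2 + ln 3) / 2) - 1 - ln t - ln 2))); last by ring.
  rewrite ler_pM2l//.
  by move: lnt l3 t2 l2; set a := ln t; set b := ln 2; set c := ln 3; nra.
have kN0 : 0 < kap * N by rewrite mulr_gt0.
have rd : 2 ^+ d.+2 <= r.
  rewrite -ler_ln ?posrE ?exprn_gt0// lnX// -/D; lra.
apply: le_trans (cross_count_lb rd).
(* The factor [3 * kap / D] is at most 1 because [kap <= 6 / 11] and [D >= 2]; this is why dimension
   one was treated apart. *)
have nE : n%:R = 3 / D * kap * (r * (kap * N) ^+ d.+1 / d.+1`!%:R).
  rewrite rE factS natrM -/D exprMn [kap ^+ d.+2]exprS; field.
  by rewrite !gt_eqF ?exprn_gt0// ltr0n fact_gt0.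
rewrite nE; apply: (@le_trans _ _ (1 * (r * (kap * N) ^+ d.+1 / d.+1`!%:R))).
  apply: ler_wpM2r.
    by apply: divr_ge0 => //; apply: mulr_ge0; rewrite ?ltW// exprn_gt0.
  rewrite mulrAC ler_pdivrMr//; lra.
rewrite mul1r ler_pM2r ?invr_gt0 ?ltr0n ?fact_gt0// mulrAC -exprMn mulrC.
rewrite ler_pM2r// lerXn2r ?nnegrE ?(ltW kN0)//.
exact: le_trans (ltW kN0) key.
Qed.

End numeric.

Section torus_analysis.
Local Open Scope classical_set_scope.
Local Open Scope quotient_scope.
Local Open Scope complex_scope.
Local Open Scope ring_scope.
Local Notation Re := (@complex.Re _).
Local Notation Im := (@complex.Im _).

(** * Integration over the torus *)

Section bounded_integrable.
Context d (T : measurableType d) (R : realType).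

Definition bounded_measurable (f : T -> R) :=
  measurable_fun [set: T] f /\ exists M, forall x, `|f x| <= M.

Lemma bounded_measurable_integrable (mu : {finite_measure set T -> \bar R}) f :
  bounded_measurable f -> mu.-integrable [set: T] (EFin \o f).
Proof.
move=> [mf [M fM]]; apply: measurable_bounded_integrable => //.
  by rewrite ltey_eq fin_num_measure.
exists M; split; first exact: num_real.
by move=> y My x _ /=; rewrite (le_trans (fM x))// ltW.
Qed.

Lemma bounded_measurableD (f g : T -> R) : bounded_measurable f ->
  bounded_measurable g -> bounded_measurable (fun x => f x + g x).
Proof.
move=> [mf [M fM]] [mg [N gN]]; split; first exact: measurable_funD.
by exists (M + N) => x; rewrite (le_trans (ler_normD _ _))// lerD.
Qed.

Lemma bounded_measurableM (f g : T -> R) : bounded_measurable f ->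
  bounded_measurable g -> bounded_measurable (fun x => f x * g x).
Proof.
move=> [mf [M fM]] [mg [N gN]]; split; first exact: measurable_funM.
by exists (M * N) => x; rewrite normrM ler_pM.
Qed.

Lemma bounded_measurable_cst (c : R) : bounded_measurable (fun=> c).
Proof. by split; [exact: measurable_cst|exists `|c|]. Qed.

End bounded_integrable.

Section trigonometric_integrals.
Context (R : realType).
Local Notation RT := (measurableTypeR R).
Implicit Types (d : nat).

Lemma bounded_measurable_trig (disp : measure_display) (T : measurableType disp) (h : T -> R) :
  measurable_fun setT h ->
  bounded_measurable (fun x => cos (h x)) /\ bounded_measurable (fun x => sin (h x)).
Proof.
move=> mh; split; (split; last by exists 1 => x; rewrite ?cos_max ?sin_max).
- apply: (@measurableT_comp _ _ _ _ _ _ cos) => //.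
  by apply: continuous_measurable_fun; exact: continuous_cos.
- apply: (@measurableT_comp _ _ _ _ _ _ sin) => //.
  by apply: continuous_measurable_fun; exact: continuous_sin.
Qed.

Lemma Rintegral_circle (f : RT -> R) : bounded_measurable f ->
  \int[circle_measure R]_x f x =
  \int[@lebesgue_measure R]_(x in `[0%R, (2 * pi)%R]) f x.
Proof.
move=> bf; congr fine; pose I := `[0%R, (2 * pi)%R]%classic : set RT.
have mI : measurable I by exact: measurable_itv.
rewrite (@negligible_integral _ _ _ (circle_measure R) setT (~` I))//; last 3 first.
- exact: measurableC.
- exact: bounded_measurable_integrable.
- by rewrite /= /mfrestr /mrestr setICl measure0.
rewrite setTD setCK; apply: eq_measure_integral => A mA AI.
by rewrite /= /mfrestr /mrestr setIidl.
Qed.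

(** Change of variables along [tcons], then Fubini; a bounded function is integrable because the
    product measure is finite. *)
Lemma Rintegral_torusS d (f : d.+1.-tuple RT -> R) : bounded_measurable f ->
  \int[torus_measure R d.+1]_x f x =
  \int[circle_measure R]_x \int[torus_measure R d]_y f (tcons (x, y)).
Proof.
move=> [mf [M fM]].
have bf2 : bounded_measurable (f \o @tcons R d).
  split; last by exists M => x; exact: fM.
  by apply: (measurableT_comp mf); exact: measurable_tcons.
have mf' : measurable_fun setT (EFin \o f) by exact/measurable_EFinP.
have int2 : (circle_measure R \x torus_measure R d)%E.-integrable setT
    (EFin \o (f \o @tcons R d)).
  apply/integrableP; split; first by apply/measurable_EFinP; case: bf2.
  apply: (@le_lt_trans _ _ 
    (\int[(circle_measure R \x torus_measure R d)%E]_x (cst `|M|%:E x))%E).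
    apply: ge0_le_integral => //.
    - by apply: measurableT_comp => //; apply/measurable_EFinP; case: bf2.
    - by move=> x _; rewrite lee_fin (le_trans (fM _))// ler_norm.
  rewrite integral_cst// lte_mul_pinfty// -setXTT [ltLHS]product_measure1E//.
  by rewrite lte_mul_pinfty ?fin_num_measure// ltey_eq fin_num_measure.
rewrite /Rintegral.
transitivity (fine (\int[(circle_measure R \x torus_measure R d)%E]_z (f (tcons z))%:E)).
  congr fine.
  exact: (@integral_pushforward _ _ _ _ R (@tcons R d) (@measurable_tcons R d)
    (circle_measure R \x torus_measure R d)%E setT (EFin \o f)).
rewrite -(integral12_prod_meas1 int2); congr fine; apply: eq_integral => x _.
rewrite /fubini_F fineK//.
apply: integrable_fin_num => //.
apply: (@bounded_measurable_integrable _ _ _ (torus_measure R d) (fun y => f (tcons (x, y)))).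
split; last by exists M => y; exact: fM.
apply: (measurableT_comp mf); apply: (measurableT_comp (@measurable_tcons R d)).
exact: measurable_pair1.
Qed.


Lemma Rintegral_derive (F f : R -> R) (a b : R) : a < b -> continuous f ->
  (forall x : R, is_derive x (1 : R) F (f x)) ->
  \int[@lebesgue_measure R]_(x in `[a, b]) f x = F b - F a.
Proof.
move=> ab cf dF.
have dvF x : derivable F x 1 by case: (dF x).
have cF x : {for x, continuous F}.
  by apply/differentiable_continuous/derivable1_diffP.
rewrite /Rintegral (@continuous_FTC2 _ f F)//.
- exact: continuous_subspaceT.
- split => //.
  + by apply: cvg_at_right_filter; exact: cF.
  + by apply: cvg_at_left_filter; exact: cF.
- by move=> x _; rewrite derive1E; have -> := @derive_val _ _ _ _ _ _ _ (dF x).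
Qed.

Lemma cos_sin_intM2pi (a : int) :
  cos (a%:~R * (2 * pi)) = 1 :> R /\ sin (a%:~R * (2 * pi)) = 0 :> R.
Proof.
have key (n : nat) : cos (n%:R * (2 * pi)) = 1 :> R /\ sin (n%:R * (2 * pi)) = 0 :> R.
  have E : n%:R * (2 * pi) = 0 + (pi *+ 2) *+ n :> R.
    by rewrite add0r -[pi *+ 2]mulr_natl -[RHS]mulr_natl.
  by rewrite E (periodicn (@cosD2pi R)) (periodicn (@sinD2pi R)) cos0 sin0.
case: a => n; first exact: key.
by rewrite NegzE intrN mulNr cosN sinN; have [-> ->] := key n.+1; rewrite oppr0.
Qed.

Lemma circle_measureT : fine (circle_measure R setT) = 2 * pi.
Proof.
rewrite /= /mfrestr /mrestr setTI lebesgue_measure_itv/= lte_fin mulr_gt0 ?pi_gt0//.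
by rewrite -EFinD subr0.
Qed.

Lemma Rintegral_circle_trig (a : int) :
  \int[circle_measure R]_x cos (a%:~R * x) = (if a == 0 then 2 * pi else 0) /\
  \int[circle_measure R]_x sin (a%:~R * x) = 0.
Proof.
have [->|a0] := eqVneq a 0.
  rewrite /=; under eq_Rintegral do rewrite mul0r cos0.
  under [X in _ /\ X = _]eq_Rintegral do rewrite mul0r sin0.
  by rewrite !Rintegral_cst// mul1r mul0r circle_measureT.
have a0R : a%:~R != 0 :> R by rewrite intr_eq0.
have ma : measurable_fun setT (fun x : RT => a%:~R * x).
  by apply: measurable_funM => //; exact: measurable_cst.
have [bc bs] := bounded_measurable_trig ma.
have [c2 s2] := cos_sin_intM2pi a.
have cM : continuous (fun x : R => a%:~R * x).
  by move=> x; apply: cvgM; [exact: cvg_cst|exact: cvg_id].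
have pi2 : (0 : R) < 2 * pi by rewrite mulr_gt0// pi_gt0.
rewrite !Rintegral_circle//; split.
- have dF (x : R) : is_derive x (1 : R) (fun x => a%:~R^-1 * sin (a%:~R * x))
      (cos (a%:~R * x)).
    by apply: is_derive_eq; rewrite /GRing.scale/=; field.
  rewrite (Rintegral_derive pi2 _ dF) ?s2 ?mulr0 ?sin0 ?mulr0 ?subrr// => x.
  by apply: continuous_comp; [exact: cM|exact: continuous_cos].
- have dF (x : R) : is_derive x (1 : R) (fun x => - a%:~R^-1 * cos (a%:~R * x))
      (sin (a%:~R * x)).
    by apply: is_derive_eq; rewrite /GRing.scale/=; field.
  rewrite (Rintegral_derive pi2 _ dF) ?c2 ?mulr0 ?cos0 ?mulr1 ?subrr// => x.
  by apply: continuous_comp; [exact: cM|exact: continuous_sin].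
Qed.

Lemma measurable_torus_dot d (k : d.-tuple int) :
  measurable_fun setT (torus_dot k : d.-tuple RT -> R).
Proof.
apply: measurable_sum => j; apply: measurable_funM => //; exact: measurable_tnth.
Qed.

(** Induction on the dimension by the addition formulas; cosine and sine are treated together since
    each expansion involves both. *)
Lemma Rintegral_torus_trig d (k : d.-tuple int) :
  \int[torus_measure R d]_x cos (torus_dot k x) =
    (if all (pred1 0) k then (2 * pi) ^+ d else 0) /\
  \int[torus_measure R d]_x sin (torus_dot k x) = 0.
Proof.
elim: d k => [|d IH] k.
  have E (x : 0.-tuple RT) : torus_dot k x = 0 by rewrite /torus_dot big_ord0.
  under eq_Rintegral do rewrite E cos0.
  under [X in _ /\ X = _]eq_Rintegral do rewrite E sin0.
  rewrite !Rintegral_cst// mul0r mul1r (tuple0 k).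
  by rewrite /= indicE in_setT.
case: (tupleP k) => a {}k.
have [C' S'] := IH k; have [C1 S1] := Rintegral_circle_trig a.
have [bC bS] := bounded_measurable_trig (measurable_torus_dot [tuple of a :: k]).
have [bc bs] := bounded_measurable_trig (measurable_torus_dot k).
have ma : measurable_fun setT (fun x : RT => a%:~R * x).
  by apply: measurable_funM => //; exact: measurable_cst.
have [bca bsa] := bounded_measurable_trig ma.
have dotE x (y : d.-tuple RT) :
    torus_dot [tuple of a :: k] (tcons (x, y)) = a%:~R * x + torus_dot k y.
  rewrite /torus_dot big_ord_recl !tnth0; congr (_ + _).
  by apply: eq_bigr => j _; rewrite !tnthS.
have ic := bounded_measurable_integrable (torus_measure R d) bc.
have is_ := bounded_measurable_integrable (torus_measure R d) bs.
have ica := bounded_measurable_integrable (circle_measure R) bca.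
have isa := bounded_measurable_integrable (circle_measure R) bsa.
have iZ (mu : {finite_measure set (d.-tuple RT) -> \bar R}) b (h : d.-tuple RT -> R) :
    mu.-integrable setT (EFin \o h) -> mu.-integrable setT (EFin \o (fun x => b * h x)).
  by move=> ih; exact: (integrableZl measurableT b ih).
rewrite !Rintegral_torusS//.
under eq_Rintegral => x _.
  under eq_Rintegral do rewrite dotE cosD.
  rewrite RintegralB//; [|exact: iZ|exact: iZ].
  rewrite !RintegralZl// S' mulr0 subr0 C'.
  over.
under [X in _ /\ X = _]eq_Rintegral => x _.
  under eq_Rintegral do rewrite dotE sinD.
  rewrite RintegralD//; [|exact: iZ|exact: iZ].
  rewrite !RintegralZl// S' mulr0 addr0 C'.
  over.
rewrite /= !RintegralZr// C1 S1 mul0r; split => //.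
rewrite exprS; by case: (a == 0); case: all; rewrite /= ?mul0r ?mulr0.
Qed.

End trigonometric_integrals.

(** * Orthonormality of the characters *)

Section characters.
Context (R : realType) (d : nat).
Local Notation T := (d.-tuple (measurableTypeR R)).
Local Notation mu := (torus_measure R d).
Local Notation L2_torus := (L2 mu).
Implicit Types (k l : d.-tuple int) (f : L2_torus) (a : R[i]).

Definition char_scale : R := (2 * pi) `^ (- (d%:R / 2)).

Lemma char_scale_sq : char_scale ^+ 2 * (2 * pi) ^+ d = 1.
Proof.
have p0 : 0 < 2 * pi :> R by rewrite mulr_gt0// pi_gt0.
rewrite -powR_mulrn ?powR_ge0// -powR_mulrn ?ltW// -powRrM -powRD; last first.
  by rewrite (gt_eqF p0) implybT.
by rewrite mulNr divfK ?pnatr_eq0// addNr powRr0.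
Qed.

Definition char_fun k (x : T) : R[i] := char_scale%:C * expi (torus_dot k x).

Lemma char_fun_l2 k : char_fun k \in l2_pred mu.
Proof.
have [[mc _] [ms _]] := bounded_measurable_trig (@measurable_torus_dot R d k).
rewrite inE; split.
  split.
    rewrite (_ : _ \o _ = fun x => char_scale * cos (torus_dot k x)).
      by apply: measurable_funM => //; exact: measurable_cst.
    by apply/funext => x; rewrite /= mul0r subr0.
  rewrite (_ : _ \o _ = fun x => char_scale * sin (torus_dot k x)).
    by apply: measurable_funM => //; exact: measurable_cst.
  by apply/funext => x; rewrite /= mul0r addr0.
rewrite (eq_integral (fun=> (char_scale ^+ 2)%:E)) => [|x _]; last first.
  by rewrite /char_fun normcM exprMn !normc_sqE/= expr0n addr0 cos2Dsin2 mulr1.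
by rewrite integral_cst// lte_mul_pinfty ?lee_fin ?sqr_ge0// ltey_eq fin_num_measure.
Qed.

Definition char_l2 k : l2_fun mu := L2Fun (char_fun_l2 k).
Definition char k : L2_torus := \pi_L2_torus (char_l2 k).

Lemma fourier_coef_char k l : fourier_coef k (char l) = (l == k)%:R.
Proof.
rewrite fourier_coef_pi /fourier_fun /cintegral.
(* The product of one character with the conjugate of another has the difference of the frequencies
   as its frequency. *)
pose m := [tuple tnth l j - tnth k j | j < d].
have dm (x : T) : torus_dot m x = torus_dot l x + - torus_dot k x.
  rewrite /torus_dot -sumrB; apply: eq_bigr => j _.
  by rewrite tnth_mktuple intrB mulrBl.
have [bc bs] := bounded_measurable_trig (@measurable_torus_dot R d m).
have [C S] := @Rintegral_torus_trig R d m.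
under eq_Rintegral => x _.
  rewrite (_ : Re _ = char_scale * cos (torus_dot m x)); last first.
    by rewrite dm cosD /char_fun /=; ring.
  over.
under [X in _ +i* X]eq_Rintegral => x _.
  rewrite (_ : Im _ = char_scale * sin (torus_dot m x)); last first.
    by rewrite dm sinD /char_fun /=; ring.
  over.
rewrite !RintegralZl//; last 2 first.
- exact: bounded_measurable_integrable bs.
- exact: bounded_measurable_integrable bc.
rewrite C S mulr0.
have -> : all (pred1 0) m = (l == k).
  apply/all_tnthP/eqP => [m0|lk j]; last by rewrite tnth_mktuple lk /= subrr.
  apply: eq_from_tnth => j; have := m0 j; rewrite tnth_mktuple /= subr_eq0.
  by move/eqP.
have csq := char_scale_sq.
case: (l == k); apply/eqP; rewrite eq_complex /= -/char_scale.
  by rewrite !(mulr0, mul0r) subr0 addr0 mulrA -expr2 csq !eqxx.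
  by rewrite !mulr0 subrr addr0 eqxx.
Qed.

Lemma fourier_coef0 k : fourier_coef k (0 : L2_torus) = 0.
Proof.
have := fourier_coefZD k (-1) (0 : L2_torus) 0.
by rewrite scaler0 addr0 mulN1r addNr.
Qed.

Lemma fourier_coefZ k a f : fourier_coef k (a *: f) = a * fourier_coef k f.
Proof. by rewrite -[a *: f]addr0 fourier_coefZD fourier_coef0 addr0. Qed.

Lemma fourier_coefD k f g :
  fourier_coef k (f + g : L2_torus) = fourier_coef k f + fourier_coef k g.
Proof. by rewrite -[f]scale1r fourier_coefZD mul1r scale1r. Qed.

Lemma fourier_coefB k f g :
  fourier_coef k (f - g : L2_torus) = fourier_coef k f - fourier_coef k g.
Proof. by rewrite fourier_coefD -scaleN1r fourier_coefZ mulN1r. Qed.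

Lemma fourier_coef_sum (I : Type) (r : seq I) (F : I -> L2_torus) k :
  fourier_coef k (\sum_(i <- r) F i) = \sum_(i <- r) fourier_coef k (F i).
Proof. exact: (big_morph _ (fourier_coefD k) (fourier_coef0 k)). Qed.

Lemma fourier_coef_trig (r : seq (d.-tuple int)) (a : d.-tuple int -> R[i]) k :
  uniq r -> fourier_coef k (\sum_(l <- r) a l *: char l) =
    if k \in r then a k else 0.
Proof.
move=> ur; rewrite fourier_coef_sum.
under eq_bigr do rewrite fourier_coefZ fourier_coef_char.
have [kr|kr] := boolP (k \in r).
  rewrite (bigD1_seq k)//= eqxx mulr1 big1 ?addr0// => l /negPf ->.
  by rewrite mulr0.
rewrite big_seq big1// => l lr; case: eqP => [lk|]; last by rewrite mulr0.
by rewrite -lk lr in kr.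
Qed.

Lemma L2_norm_sq_pi (f : l2_fun mu) :
  L2_norm (\pi_L2_torus f) ^+ 2 = \int[mu]_x normc (f x) ^+ 2.
Proof.
by rewrite L2_norm_pi sqr_sqrtr// Rintegral_ge0// => x _; rewrite sqr_ge0.
Qed.

Lemma l2_fun_sq_integrable (f : l2_fun mu) :
  mu.-integrable setT (fun x => (normc (f x) ^+ 2)%:E).
Proof.
have := l2_fun_valP f; rewrite inE => -[mf fi].
apply/integrableP; split; first exact/measurable_EFinP/measurable_cfun_normc_sq.
rewrite (eq_integral (fun x => (normc (f x) ^+ 2)%:E))// => x _.
by rewrite /= ger0_norm// sqr_ge0.
Qed.

(** Expand the square of [|f - a e_k|] and complete the square in [a]. Iterating this over a list of
    frequencies yields the finite Bessel and Parseval identities. *)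
Lemma L2_norm_sub_char f a k :
  L2_norm (f - a *: char k) ^+ 2 =
  L2_norm f ^+ 2 - normc (fourier_coef k f) ^+ 2 + normc (fourier_coef k f - a) ^+ 2.
Proof.
elim/quotW: f => f.
have -> : \pi_L2_torus f - a *: char k = \pi_L2_torus (- a *: char_l2 k + f).
  by rewrite pi_L2D pi_L2Z scaleNr addrC.
rewrite !L2_norm_sq_pi fourier_coef_pi.
have [ir ii] := l2_fun_expi_integrable k (l2_fun_valP f).
have i2 := l2_fun_sq_integrable f.
have iZ b (h : T -> R) : mu.-integrable setT (EFin \o h) ->
    mu.-integrable setT (EFin \o (fun x => b * h x)).
  by move=> ih; exact: (integrableZl measurableT b ih).
set A : R := \int[mu]_x normc (f x) ^+ 2.
transitivity (A - 2 * char_scale *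
    (Re a * (\int[mu]_x Re (f x * expi (- torus_dot k x))) +
     Im a * (\int[mu]_x Im (f x * expi (- torus_dot k x)))) +
    (char_scale ^+ 2 * normc a ^+ 2) * (2 * pi) ^+ d).
  (* The mass [(2 pi) ^ d] is written as the integral of the constant [o], so that the right-hand
     side merges into one integral; pointwise, [o] is then replaced by [cos ^ 2 + sin ^ 2]. *)
  pose o : R := 1.
  have -> : (2 * pi) ^+ d = \int[mu]_x (cst o x).
    have [C _] := @Rintegral_torus_trig R d [tuple (0 : int) | j < d].
    move: C; rewrite (_ : all _ _ = true); last by apply/all_tnthP => j; rewrite tnth_mktuple.
    move=> <-; apply: eq_Rintegral => x _.
    by rewrite /torus_dot big1 ?cos0// => j _; rewrite tnth_mktuple mul0r.
  have i1 : mu.-integrable setT (EFin \o cst o).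
    by apply: bounded_measurable_integrable; exact: bounded_measurable_cst.
  rewrite -!RintegralZl// -RintegralD//; try exact: iZ.
  rewrite -RintegralZl//; last first.
    exact: (integrableD measurableT (iZ _ _ ir) (iZ _ _ ii)).
  rewrite -RintegralB//; last first.
    exact: (iZ _ _ (integrableD measurableT (iZ _ _ ir) (iZ _ _ ii))).
  rewrite -RintegralD//; [|
    exact: (integrableB measurableT i2
      (iZ _ _ (integrableD measurableT (iZ _ _ ir) (iZ _ _ ii))))
    |exact: iZ].
  apply: eq_Rintegral => x _.
  have -> : (- a *: char_l2 k + f) x = - a * char_fun k x + f x by [].
  rewrite !normc_sqE /char_fun /expi cosN sinN.
  have := cos2Dsin2 (torus_dot k x); case: (f x) => u v; case: (a) => b c /=.
  set C := cos _; set S := sin _ => E.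
  have {}E : C ^+ 2 + S ^+ 2 = o by [].
  by rewrite -E; ring.
rewrite [_ ^+ 2 * _ * _]mulrAC char_scale_sq mul1r /fourier_fun -/char_scale /cintegral.
set I := \int[mu]_x _; set J := \int[mu]_x _.
by case: (a) => b c; rewrite !normc_sqE /=; ring.
Qed.

(** Induction on [r]: by orthonormality, subtracting a multiple of one character leaves the
    coefficients at the remaining frequencies unchanged. *)
Lemma L2_norm_sub_trig (r : seq (d.-tuple int)) (a : d.-tuple int -> R[i]) f :
  uniq r ->
  L2_norm (f - \sum_(k <- r) a k *: char k) ^+ 2 =
  L2_norm f ^+ 2 - \sum_(k <- r) normc (fourier_coef k f) ^+ 2
    + \sum_(k <- r) normc (fourier_coef k f - a k) ^+ 2.
Proof.
elim: r f => [|k r IH] f; first by rewrite !big_nil !subr0 addr0.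
rewrite cons_uniq => /andP[kr ur]; rewrite !big_cons opprD addrA IH// L2_norm_sub_char.
have E l : l \in r -> fourier_coef l (f - a k *: char k) = fourier_coef l f.
  move=> lr; rewrite fourier_coefB fourier_coefZ fourier_coef_char.
  by case: eqP => [kl|]; [rewrite kl lr in kr|rewrite mulr0 subr0].
have -> : \sum_(l <- r) normc (fourier_coef l (f - a k *: char k)) ^+ 2 =
    \sum_(l <- r) normc (fourier_coef l f) ^+ 2.
  by apply: eq_big_seq => l lr; rewrite E.
have -> : \sum_(l <- r) normc (fourier_coef l (f - a k *: char k) - a l) ^+ 2 =
    \sum_(l <- r) normc (fourier_coef l f - a l) ^+ 2.
  by apply: eq_big_seq => l lr; rewrite E.
ring.
Qed.

Lemma L2_norm_trig (r : seq (d.-tuple int)) (a : d.-tuple int -> R[i]) :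
  uniq r ->
  L2_norm (\sum_(k <- r) a k *: char k) ^+ 2 = \sum_(k <- r) normc (a k) ^+ 2.
Proof.
have N0 : L2_norm (0 : L2_torus) ^+ 2 = 0.
  have := L2_norm_sub_char 0 0 [tuple (0 : int) | j < d].
  rewrite scale0r fourier_coef0 !subr0 normc0 expr0n subr0 addr0.
  rewrite -(_ : \pi_L2_torus 0 = 0); last by apply: pi_zeror.
  rewrite L2_norm_sq_pi => _.
  transitivity (\int[mu]_x (cst (0 : R) x)); last by rewrite Rintegral_cst// mul0r.
  by apply: eq_Rintegral => x _; rewrite -[RHS](expr0n _ 2) -(@normc0 R).
move=> ur; have := L2_norm_sub_trig (fun k => - a k) 0 ur.
under eq_bigr do rewrite scaleNr.
rewrite sumrN opprK add0r N0 => ->.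
under eq_bigr do rewrite fourier_coef0 normc0 expr0n.
under [X in _ + X]eq_bigr do rewrite fourier_coef0 sub0r opprK.
by rewrite big1// subr0 add0r.
Qed.

End characters.

(** * The closure of the trigonometric polynomials *)

Section square_integrals.
Context disp (T : measurableType disp) (R : realType) (mu : {measure set T -> \bar R}).
Implicit Types (F G H : T -> R[i]).

(** The squared norm of a plain function, valued in the extended reals: estimates can be chained
    without proving integrability first. *)
Definition sqint F : \bar R := (\int[mu]_x (normc (F x) ^+ 2)%:E)%E.

Lemma sqint_le F G H (a b : R) : 0 <= a -> 0 <= b ->
  measurable_cfun F -> measurable_cfun G -> measurable_cfun H ->
  (forall x, normc (F x) ^+ 2 <= a * normc (G x) ^+ 2 + b * normc (H x) ^+ 2) ->
  (sqint F <= a%:E * sqint G + b%:E * sqint H)%E.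
Proof.
move=> a0 b0 mF mG mH FGH.
have sq0 (h : T -> R[i]) x : [set: T] x -> (0 <= (normc (h x) ^+ 2)%:E)%E.
  by rewrite lee_fin sqr_ge0.
have msq (h : T -> R[i]) : measurable_cfun h ->
    measurable_fun [set: T] (fun x => (normc (h x) ^+ 2)%:E).
  by move=> mh; exact/measurable_EFinP/measurable_cfun_normc_sq.
rewrite /sqint -!ge0_integralZl//; try exact: msq; try exact: sq0.
rewrite -ge0_integralD//; last 4 first.
- by move=> x _; rewrite mule_ge0// sq0.
- by apply: measurable_funeM; exact: msq.
- by move=> x _; rewrite mule_ge0// sq0.
- by apply: measurable_funeM; exact: msq.
apply: ge0_le_integral => //; first exact: sq0.
- exact: msq.
- by apply: emeasurable_funD; apply: measurable_funeM; exact: msq.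
- by move=> x _; rewrite -!EFinM -EFinD lee_fin.
Qed.

Lemma measurable_cfunB F G : measurable_cfun F -> measurable_cfun G ->
  measurable_cfun (fun x => F x - G x).
Proof.
move=> mF mG; have := @measurable_cfunZD _ _ _ (-1) G F mG mF.
by congr measurable_cfun; apply/funext => x; rewrite -[LHS]/(-1 * G x + F x) mulN1r addrC.
Qed.

Lemma measurable_cfun_real (f : T -> R) : measurable_fun setT f ->
  measurable_cfun (fun x => (f x)%:C).
Proof. by move=> mf; split => //; exact: measurable_cst. Qed.

End square_integrals.

Section trigonometric_polynomials.
Context (R : realType) (d : nat).
Local Notation T := (d.-tuple (measurableTypeR R)).
Local Notation mu := (torus_measure R d).
Implicit Types (p q : T -> R[i]) (f g : T -> R) (k l : d.-tuple int).

(** Frequencies may repeat in the list, so that sums are concatenations and products are lists of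
    pairs. *)
Definition trig_poly p := exists s : seq (R[i] * d.-tuple int),
  p = fun x => \sum_(t <- s) t.1 * expi (torus_dot t.2 x).

Lemma expiD (s t : R) : expi (s + t) = expi s * expi t.
Proof.
apply/eqP; rewrite /expi eq_complex /= cosD sinD; apply/andP; split=> //.
by rewrite addrC [cos s * sin t + _]addrC eqxx.
Qed.

Lemma trig_polyZD (a : R[i]) p q : trig_poly p -> trig_poly q ->
  trig_poly (fun x => a * p x + q x).
Proof.
move=> [s ->] [t ->]; exists ([seq (a * u.1, u.2) | u <- s] ++ t).
apply/funext => x; rewrite big_cat big_map /= mulr_sumr; congr (_ + _).
by apply: eq_bigr => u _; rewrite mulrA.
Qed.

Lemma trig_polyM p q : trig_poly p -> trig_poly q -> trig_poly (fun x => p x * q x).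
Proof.
move=> [s ->] [t ->].
exists [seq (u.1 * v.1, [tuple tnth u.2 j + tnth v.2 j | j < d]) | u <- s, v <- t].
apply/funext => x; rewrite big_allpairs_dep /= mulr_suml.
apply: eq_bigr => u _; rewrite mulr_sumr; apply: eq_bigr => v _ /=.
rewrite mulrACA -expiD; congr (_ * expi _).
rewrite /torus_dot -big_split /=; apply: eq_bigr => j _.
by rewrite tnth_mktuple intrD mulrDl.
Qed.

Lemma trig_poly_bounded p : trig_poly p ->
  measurable_cfun p /\ exists2 M, 0 <= M & forall x, normc (p x) ^+ 2 <= M.
Proof.
move=> [s ->]; elim: s => [|[a k] s [IHm [M M0 IHM]]].
  split; first by split; rewrite (_ : _ \o _ = cst 0) ?measurable_cst//;
    apply/funext => x; rewrite /= big_nil.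
  by exists 0 => // x; rewrite big_nil normc0 expr0n.
have [[mc _] [ms _]] := bounded_measurable_trig (@measurable_torus_dot R d k).
split.
  have := @measurable_cfunZD _ _ _ a (fun x => expi (torus_dot k x)) _ (conj mc ms) IHm.
  by congr measurable_cfun; apply/funext => x; rewrite big_cons.
exists (2 * (normc a ^+ 2 + M)) => [|x]; first by rewrite mulr_ge0// addr_ge0// sqr_ge0.
rewrite big_cons (le_trans (normc_sqD _ _))// ler_pM2l// lerD//.
by rewrite normcM exprMn [X in _ * X]normc_sqE /= cos2Dsin2 mulr1.
Qed.

Definition trig_approx (F : T -> R[i]) := forall e : R, 0 < e ->
  exists2 p, trig_poly p & (sqint mu (fun x => F x - p x)%R <= e%:E)%E.

(** Boundedness makes this class stable under products; real values give a meaning to the sets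
    [{f > a}]. *)
Definition trig_closure f := bounded_measurable f /\ trig_approx (fun x => (f x)%:C).

Lemma trig_approxZD (a : R[i]) (F G : T -> R[i]) :
  measurable_cfun F -> measurable_cfun G -> trig_approx F -> trig_approx G ->
  trig_approx (fun x => a * F x + G x).
Proof.
move=> mF mG aF aG e e0.
have a0 : 0 <= normc a ^+ 2 by rewrite sqr_ge0.
(* The doubling in [normc_sqD] turns the two errors into at most [e / 2] each; the added 1 keeps the
   denominator positive. *)
have e1 : 0 < e / (4 * (normc a ^+ 2 + 1)) by apply: divr_gt0 => //; move: a0; lra.
have e4 : 0 < e / 4 by rewrite divr_gt0.
have [p tp pe] := aF _ e1; have [q tq qe] := aG _ e4.
have [mp _] := trig_poly_bounded tp; have [mq _] := trig_poly_bounded tq.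
exists (fun x => a * p x + q x); first exact: trig_polyZD.
apply: (@le_trans _ _ ((2 * normc a ^+ 2)%:E * sqint mu (fun x => F x - p x)%R +
   2%:E * sqint mu (fun x => G x - q x)%R)%E).
  apply: sqint_le => //; first by rewrite mulr_ge0.
  - by apply: measurable_cfunB; apply: measurable_cfunZD.
  - exact: measurable_cfunB.
  - exact: measurable_cfunB.
  - move=> x; rewrite (_ : _ - _ = a * (F x - p x) + (G x - q x)); last by ring.
    by rewrite (le_trans (normc_sqD _ _))// normcM exprMn mulrDr mulrA.
apply: (le_trans (leeD (lee_wpmul2l _ pe) (lee_wpmul2l _ qe))).
- by rewrite lee_fin mulr_ge0.
- by rewrite lee_fin.
rewrite -!EFinM -EFinD lee_fin.
rewrite (_ : e = e / 2 + e / 2); last by field.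
apply: lerD; last by rewrite le_eqVlt; apply/orP; left; apply/eqP; field.
by rewrite mulrA ler_pdivrMr; move: a0 e0; set c := _ ^+ 2; nra.
Qed.

Lemma trig_closureZD (a : R) f g : trig_closure f -> trig_closure g ->
  trig_closure (fun x => a * f x + g x).
Proof.
move=> [bf af] [bg ag]; split.
  by apply: bounded_measurableD => //; apply: bounded_measurableM => //;
    exact: bounded_measurable_cst.
have := trig_approxZD a%:C (measurable_cfun_real bf.1) (measurable_cfun_real bg.1) af ag.
by congr trig_approx; apply/funext => x; rewrite rmorphD rmorphM.
Qed.

(** [f g - p q = f (g - q) + q (f - p)]. The polynomial [q] is chosen first, since the accuracy
    demanded of [p] depends on the bound of [q]. *)
Lemma trig_closureM f g : trig_closure f -> trig_closure g ->
  trig_closure (fun x => f x * g x).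
Proof.
move=> [bf af] [bg ag]; split; first exact: bounded_measurableM.
have mf := measurable_cfun_real bf.1; have mg := measurable_cfun_real bg.1.
move=> e e0; have [Mf fM] := bf.2.
have Mf0 : 0 <= Mf ^+ 2 by rewrite sqr_ge0.
have e1 : 0 < e / (4 * (Mf ^+ 2 + 1)) by apply: divr_gt0 => //; move: Mf0; lra.
have [q tq qe] := ag _ e1.
have [mq [Mq Mq0 qM]] := trig_poly_bounded tq.
have e2 : 0 < e / (4 * (Mq + 1)) by apply: divr_gt0 => //; move: Mq0; lra.
have [p tp pe] := af _ e2.
have [mp _] := trig_poly_bounded tp.
exists (fun x => p x * q x); first exact: trig_polyM.
apply: (@le_trans _ _ ((2 * Mf ^+ 2)%:E * sqint mu (fun x => (g x)%:C - q x)%R +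
   (2 * Mq)%:E * sqint mu (fun x => (f x)%:C - p x)%R)%E).
  apply: sqint_le; [by apply: mulr_ge0|by apply: mulr_ge0|..].
  - apply: measurable_cfunB; last by have [] := trig_poly_bounded (trig_polyM tp tq).
    exact: measurable_cfun_real (bounded_measurableM bf bg).1.
  - exact: measurable_cfunB.
  - exact: measurable_cfunB.
  - move=> x; rewrite (_ : _ - _ =
      (f x)%:C * ((g x)%:C - q x) + q x * ((f x)%:C - p x)); last first.
      by rewrite rmorphM; ring.
    rewrite (le_trans (normc_sqD _ _))// !normcM !exprMn mulrDr.
    rewrite -[2 * Mf ^+ 2 * _]mulrA -[2 * Mq * _]mulrA.
    apply: lerD; rewrite ler_pM2l// ler_wpM2r// ?sqr_ge0//.
    rewrite normc_sqE /= expr0n addr0 -real_normK ?num_real//.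
    by rewrite lerXn2r ?nnegrE ?(le_trans _ (fM x)).
apply: (le_trans (leeD (lee_wpmul2l _ qe) (lee_wpmul2l _ pe))).
- by rewrite lee_fin mulr_ge0.
- by rewrite lee_fin mulr_ge0.
rewrite -!EFinM -EFinD lee_fin (_ : e = e / 2 + e / 2); last by field.
by apply: lerD; rewrite mulrA ler_pdivrMr; move: Mf0 Mq0 e0; set c := _ ^+ 2; nra.
Qed.

Lemma trig_approx_lim (F : T -> R[i]) (F_ : nat -> T -> R[i]) :
  measurable_cfun F -> (forall n, measurable_cfun (F_ n)) ->
  (forall n, trig_approx (F_ n)) ->
  (sqint mu (fun x => F x - F_ n x)%R @[n --> \oo] --> 0)%E ->
  trig_approx F.
Proof.
move=> mF mF_ aF_ cF e e0.
have e4 : 0 < e / 4 by rewrite divr_gt0.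
have [n ne] : exists n, (sqint mu (fun x => F x - F_ n x)%R < (e / 4)%:E)%E.
  have [n _ nP] : \forall n \near \oo, (sqint mu (fun x => F x - F_ n x)%R < (e / 4)%:E)%E.
    by apply: (cF _ (open_ereal_lt' _)); rewrite lte_fin.
  by exists n; exact: (nP n (leqnn n)).
have [p tp pe] := aF_ n _ e4; have [mp _] := trig_poly_bounded tp.
exists p => //.
apply: (@le_trans _ _ (2%:E * sqint mu (fun x => F x - F_ n x)%R +
   2%:E * sqint mu (fun x => F_ n x - p x)%R)%E).
  apply: sqint_le => //; try exact: measurable_cfunB.
  move=> x; rewrite (_ : _ - _ = (F x - F_ n x) + (F_ n x - p x)); last by ring.
  by rewrite -mulrDr normc_sqD.
apply: (le_trans (leeD (lee_wpmul2l _ (ltW ne)) (lee_wpmul2l _ pe))).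
- by rewrite lee_fin.
- by rewrite lee_fin.
by rewrite -!EFinM -EFinD lee_fin; lra.
Qed.

Lemma sqint_dominated_cvg (f g : T -> R) (f_ : nat -> T -> R) :
  measurable_fun setT f -> (forall n, measurable_fun setT (f_ n)) ->
  mu.-integrable setT (EFin \o g) -> (forall n x, (f x - f_ n x) ^+ 2 <= g x) ->
  {ae mu, forall x, f_ n x @[n --> \oo] --> f x} ->
  (sqint mu (fun x => (f x)%:C - (f_ n x)%:C)%R @[n --> \oo] --> 0)%E.
Proof.
move=> mf mf_ ig fg cf.
have E n : sqint mu (fun x => (f x)%:C - (f_ n x)%:C) =
    (\int[mu]_x ((f x - f_ n x) ^+ 2)%:E)%E.
  by apply: eq_integral => x _; rewrite normc_sqE /= oppr0 addr0 expr0n addr0.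
under eq_cvg do rewrite E.
have [] := @dominated_convergence _ _ _ mu setT measurableT
  (fun n x => ((f x - f_ n x) ^+ 2)%:E) (cst 0%E) (EFin \o g).
- move=> n; apply/measurable_EFinP; apply: measurable_funX.
  exact: measurable_funB.
- exact: measurable_cst.
- apply: filterS cf => x cx _; apply: cvg_EFin; first by apply: nearW.
  have c0 : f x - f_ n x @[n --> \oo] --> (0 : R).
    by rewrite -(subrr (f x)); exact: (cvgB (cvg_cst (f x)) cx).
  have c1 : (f x - f_ n x) * (f x - f_ n x) @[n --> \oo] --> (0 * 0 : R).
    exact: (cvgM c0 c0).
  by rewrite mulr0 in c1; exact: c1.
- by [].
- by apply: aeW => x n _; rewrite /= lee_fin ger0_norm ?sqr_ge0.
- by move=> _ _; rewrite integral0.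
Qed.

Lemma trig_closure_lim f (f_ : nat -> T -> R) (M : R) :
  measurable_fun setT f -> (forall x, `|f x| <= M) ->
  (forall n, trig_closure (f_ n)) -> (forall n x, `|f_ n x| <= M) ->
  {ae mu, forall x, f_ n x @[n --> \oo] --> f x} -> trig_closure f.
Proof.
move=> mf fM tf_ f_M cf; split; first by split => //; exists M.
apply: (@trig_approx_lim _ (fun n x => (f_ n x)%:C)).
- exact: measurable_cfun_real.
- by move=> n; apply: measurable_cfun_real; case: (tf_ n) => -[].
- by move=> n; case: (tf_ n).
apply: (@sqint_dominated_cvg _ (fun=> (2 * M) ^+ 2)) => //.
- by move=> n; case: (tf_ n) => -[].
- by apply: bounded_measurable_integrable; exact: bounded_measurable_cst.
- move=> n x; rewrite -real_normK ?num_real// lerXn2r ?nnegrE//.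
    by rewrite (le_trans _ (_ : `|f x| + `|f x| <= _))// ?addr_ge0// mulr2n mulrDl mul1r lerD.
  by rewrite (le_trans (ler_normB _ _))// mulr2n mulrDl mul1r lerD.
Qed.

End trigonometric_polynomials.

(** * A polynomial iteration that converges to a step function *)

Section smoothstep.
Context (R : realType).
Implicit Types u : R.

(* The polynomial 3 u^2 - 2 u^3 maps [0, 1] to itself; its fixed points there are
   0 and 1, both attracting, and 1 / 2. *)
Definition smoothstep u := u * (u * (3 - 2 * u)).

Lemma smoothstep_itv u : 0 <= u <= 1 -> 0 <= smoothstep u <= 1.
Proof.
move=> /andP[u0 u1]; rewrite /smoothstep; apply/andP; split.
  by rewrite !mulr_ge0//; lra.
rewrite -subr_ge0 (_ : _ - _ = (1 - u) * ((1 - u) * (1 + 2 * u))); last by ring.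
by rewrite !mulr_ge0//; lra.
Qed.

Lemma iter_smoothstep_itv n u : 0 <= u <= 1 -> 0 <= iter n smoothstep u <= 1.
Proof. by move=> u01; elim: n => //= n IH; exact: smoothstep_itv. Qed.

(** The symmetry about [1 / 2], which reduces starting points above [1 / 2] to those below. *)
Lemma iter_smoothstepC n u : iter n smoothstep (1 - u) = 1 - iter n smoothstep u.
Proof. by elim: n => //= n ->; rewrite /smoothstep; ring. Qed.

(** A step multiplies [v] by [v * (3 - 2 * v)], which for [v <= u] is at most its value [rho < 1] at
    [u]; the decay is geometric. *)
Lemma iter_smoothstep_lt u : 0 <= u -> u < 1 / 2 ->
  iter n smoothstep u @[n --> \oo] --> (0 : R).
Proof.
move=> u0 u2; pose rho := u * (3 - 2 * u).
have rho0 : 0 <= rho by rewrite mulr_ge0//; lra.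
have rho1 : rho < 1 by rewrite /rho; nra.
have key n : 0 <= iter n smoothstep u <= u * rho ^+ n.
  elim: n => [|n /andP[v0 vu]]; first by rewrite expr0 mulr1 u0 lexx.
  rewrite iterS.
  set v := iter n _ _ in v0 vu *.
  have vu' : v <= u by rewrite (le_trans vu)// ler_piMr// exprn_ile1// ltW.
  have vr : v * (3 - 2 * v) <= rho by rewrite /rho; nra.
  have v3 : 0 <= v * (3 - 2 * v) by rewrite mulr_ge0//; lra.
  by rewrite /smoothstep mulr_ge0//= exprSr [leRHS]mulrA ler_pM.
apply: (@squeeze_cvgr _ _ _ _ (cst 0) (fun n => u * rho ^+ n)).
- by apply: nearW => n; exact: key.
- exact: cvg_cst.
- by apply: cvg_geometric; rewrite ger0_norm.
Qed.

Lemma iter_smoothstep_lim u : 0 <= u <= 1 ->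
  iter n smoothstep u @[n --> \oo] --> (((1 / 2 < u)%R%:R + (1 / 2 <= u)%R%:R) / 2 : R).
Proof.
move=> /andP[u0 u1]; have [u2|u2|u2] := ltgtP u (1 / 2); rewrite /=.
- rewrite addr0 mul0r; exact: iter_smoothstep_lt.
- rewrite (_ : _ / 2 = 1 - 0); last by field.
  rewrite (_ : u = 1 - (1 - u)); last by ring.
  under eq_cvg do rewrite iter_smoothstepC.
  by apply: (cvgB (cvg_cst (1 : R))); apply: iter_smoothstep_lt; lra.
- rewrite add0r u2 (_ : (fun _ => _) = cst (1 / 2)); first exact: cvg_cst.
  by apply/funext => n; elim: n => //= n ->; rewrite /smoothstep; field.
Qed.

End smoothstep.

(** * Sets whose indicator is a limit of trigonometric polynomials *)

Section density.
Context (R : realType) (d : nat).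
Local Notation RT := (measurableTypeR R).
Local Notation T := (d.-tuple RT).
Local Notation mu := (torus_measure R d).
Implicit Types (p q : T -> R[i]) (f g : T -> R) (A B : set T) (j : 'I_d).

Lemma trig_closure_poly f : bounded_measurable f ->
  trig_poly (fun x => (f x)%:C) -> trig_closure f.
Proof.
move=> bf tf; split => // e e0; exists (fun x => (f x)%:C) => //.
rewrite /sqint (eq_integral (cst 0%E)) ?integral0 ?lee_fin ?(ltW e0)// => x _.
by rewrite subrr normc0 expr0n.
Qed.

Lemma trig_closure_cst (c : R) : trig_closure (fun _ : T => c).
Proof.
apply: trig_closure_poly; first exact: bounded_measurable_cst.
exists [:: (c%:C, [tuple 0 | j < d])]; apply/funext => x.
rewrite big_seq1 /= (_ : torus_dot _ _ = 0).
  by rewrite /expi cos0 sin0 [1 +i* 0]/(1 : R[i]) mulr1.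
by rewrite /torus_dot big1// => j _; rewrite tnth_mktuple mul0r.
Qed.

Lemma trig_closure_coord j :
  trig_closure (fun x : T => cos (tnth x j)) /\ trig_closure (fun x : T => sin (tnth x j)).
Proof.
pose del (c : int) := [tuple (if i == j then c else 0) | i < d].
have dotE (c : int) (x : T) : torus_dot (del c) x = c%:~R * tnth x j.
  rewrite /torus_dot (bigD1 j)//= tnth_mktuple eqxx big1 ?addr0// => i /negPf ij.
  by rewrite tnth_mktuple ij mul0r.
have [bc bs] := bounded_measurable_trig (@measurable_tnth _ RT d j).
split; apply: trig_closure_poly => //.
- exists [:: ((1 / 2)%:C, del 1); ((1 / 2)%:C, del (-1))]; apply/funext => x.
  rewrite big_cons big_seq1 /= !dotE mulr1z !mul1r mulN1r /expi cosN sinN.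
  by apply/eqP; rewrite eq_complex /=; apply/andP; split; apply/eqP; field.
- exists [:: (0 +i* (- (1 / 2)), del 1); (0 +i* (1 / 2), del (-1))]; apply/funext => x.
  rewrite big_cons big_seq1 /= !dotE mulr1z !mul1r mulN1r /expi cosN sinN.
  by apply/eqP; rewrite eq_complex /=; apply/andP; split; apply/eqP; field.
Qed.

Lemma trig_closureD f g : trig_closure f -> trig_closure g ->
  trig_closure (fun x => f x + g x).
Proof.
move=> tf tg; have := trig_closureZD 1 tf tg.
by congr trig_closure; apply/funext => x; rewrite mul1r.
Qed.

Lemma trig_closureZ (c : R) f : trig_closure f -> trig_closure (fun x => c * f x).
Proof.
move=> tf; have := trig_closureZD c tf (trig_closure_cst 0).
by congr trig_closure; apply/funext => x; rewrite addr0.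
Qed.

Definition trig_set A := measurable A /\ trig_closure (\1_A : T -> R).

Lemma trig_set_gt f (a : R) : trig_closure f -> trig_set [set x | a < f x].
Proof.
move=> tf; have [[mf [M fM]] _] := tf.
have mgt : measurable [set x | a < f x].
  rewrite (_ : mkset _ = f @^-1` `]a, +oo[); last first.
    by apply/seteqP; split => x /=; rewrite in_itv/= andbT.
  by rewrite -[X in measurable X]setTI; apply: mf => //; exact: measurable_itv.
have mge : measurable [set x | a <= f x].
  rewrite (_ : mkset _ = f @^-1` `[a, +oo[); last first.
    by apply/seteqP; split => x /=; rewrite in_itv/= andbT.
  by rewrite -[X in measurable X]setTI; apply: mf => //; exact: measurable_itv.
(* Chosen so that [|f - a| <= c / 2]; then [u = 1 / 2 + (f - a) / c] stays in [[0, 1]] and crosses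
   [1 / 2] exactly where [f] crosses [a]. *)
pose c : R := 2 * (`|M| + `|a| + 1).
have c0 : 0 < c by rewrite mulr_gt0// ltr_wpDl// addr_ge0.
pose u x := c^-1 * f x + (1 / 2 - a / c).
have u01 x : 0 <= u x <= 1.
  have : `|f x - a| <= c / 2.
    rewrite (le_trans (ler_normB _ _))// (_ : c / 2 = `|M| + `|a| + 1); last first.
      by rewrite /c; field.
    by rewrite (le_trans (lerD (le_trans (fM x) (ler_norm M)) (lexx _)))// lerDl.
  rewrite -(ler_pM2r (_ : 0 < c^-1)) ?invr_gt0//.
  rewrite (_ : c / 2 / c = 1 / 2); last by field; rewrite gt_eqF.
  rewrite -[X in _ * X](gtr0_norm (_ : 0 < c^-1)) ?invr_gt0// -normrM ler_norml.
  by rewrite mulrBl /u [f x * _]mulrC => /andP[]; set v := _ * f x; set w := a / c; lra.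
have u_gt x : (1 / 2 < u x) = (a < f x).
  rewrite -[RHS](ltr_pM2l (_ : 0 < c^-1)) ?invr_gt0// /u [c^-1 * a]mulrC.
  by apply/idP/idP; lra.
have u_ge x : (1 / 2 <= u x) = (a <= f x).
  rewrite -[RHS](ler_pM2l (_ : 0 < c^-1)) ?invr_gt0// /u [c^-1 * a]mulrC.
  by apply/idP/idP; lra.
have tu : trig_closure u by apply: trig_closureZD => //; exact: trig_closure_cst.
have tn n : trig_closure (fun x => iter n (@smoothstep R) (u x)).
  elim: n => //= n IH; apply: trig_closureM => //; apply: trig_closureM => //.
  have := trig_closureZD (-2) IH (trig_closure_cst 3).
  by congr trig_closure; apply/funext => x; ring.
pose w x : R := 1 / 2 * \1_[set x | a < f x] x + 1 / 2 * \1_[set x | a <= f x] x.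
have wE x : w x = (((1 / 2 < u x)%R%:R + (1 / 2 <= u x)%R%:R) / 2 : R).
  rewrite /w !indicE u_gt u_ge.
  have -> : (x \in [set x | a < f x]) = (a < f x) by apply/idP/idP; rewrite inE.
  have -> : (x \in [set x | a <= f x]) = (a <= f x) by apply/idP/idP; rewrite inE.
  by field.
have tw : trig_closure w.
  apply: (@trig_closure_lim _ _ _ (fun n x => iter n (@smoothstep R) (u x)) 1) => //.
  - apply: measurable_funD; apply: measurable_funM;
      (try exact: measurable_cst); exact: measurable_indic.
  - by move=> x; rewrite wE; case: (_ < u x); case: (_ <= u x);
      rewrite /= ?mulr1n ?mulr0n ger0_norm; lra.
  - by move=> n x; have /andP[? ?] := iter_smoothstep_itv n (u01 x); rewrite ger0_norm.
  - by apply: aeW => x; rewrite wE; exact: iter_smoothstep_lim.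
split => //.
(* w is 1, 1 / 2 or 0 according to the sign of f - a, and 2 w^2 - w is 1, 0, 0. *)
have := trig_closureD (trig_closureZ 2 (trig_closureM tw tw)) (trig_closureZ (-1) tw).
congr trig_closure; apply/funext => x; rewrite /w !indicE.
have -> : (x \in [set x | a < f x]) = (a < f x) by apply/idP/idP; rewrite inE.
have -> : (x \in [set x | a <= f x]) = (a <= f x) by apply/idP/idP; rewrite inE.
by have [| |] := ltgtP a (f x); rewrite /=; lra.
Qed.

Lemma trig_set0 : trig_set set0.
Proof. by split => //; rewrite indic0; exact: trig_closure_cst. Qed.

Lemma trig_setC A : trig_set A -> trig_set (~` A).
Proof.
move=> [mA tA]; split; first exact: measurableC.
have := trig_closureZD (-1) tA (trig_closure_cst 1).
congr trig_closure; apply/funext => x; rewrite indicC indicE.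
by case: (x \in A); rewrite /= ?mulr1 ?mulr0 ?add0r// addNr.
Qed.

Lemma trig_setI A B : trig_set A -> trig_set B -> trig_set (A `&` B).
Proof.
move=> [mA tA] [mB tB]; split; first exact: measurableI.
by rewrite indicI; exact: trig_closureM.
Qed.

Lemma trig_setU A B : trig_set A -> trig_set B -> trig_set (A `|` B).
Proof.
move=> tA tB; rewrite -[A `|` B]setCK setCU.
by apply/trig_setC/trig_setI; exact: trig_setC.
Qed.

Lemma normr_indic_le1 A (x : T) : `|\1_A x| <= 1 :> R.
Proof. by rewrite indicE normr_nat lern1 leq_b1. Qed.

Lemma trig_set_bigcup (F : nat -> set T) : (forall n, trig_set (F n)) ->
  trig_set (\bigcup_n F n).
Proof.
move=> tF; have mF : measurable (\bigcup_n F n).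
  by apply: bigcup_measurable => n _; case: (tF n).
split => //.
have tU n : trig_set (\big[setU/set0]_(i < n) F i).
  by elim/big_ind: _ => //; [exact: trig_set0|exact: trig_setU].
apply: (@trig_closure_lim _ _ _ (fun n => \1_(\big[setU/set0]_(i < n) F i)) 1).
- exact: measurable_indic.
- exact: normr_indic_le1.
- by move=> n; case: (tU n).
- by move=> n x; exact: normr_indic_le1.
- apply: aeW => x /=; have [[n _ Fnx]|nF] := pselect ((\bigcup_n F n) x).
    apply: (@cvg_near_cst _ _ _ _ _ _ _).
    exists n.+1 => // m /= nm; rewrite !indicE !mem_set//; first by exists n.
    by rewrite -bigcup_mkord; exists n.
  apply: (@cvg_near_cst _ _ _ _ _ _ _); apply: nearW => n.
  rewrite !indicE !memNset// -bigcup_mkord => -[m _ Fmx].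
  by apply: nF; exists m.
Qed.

(** The constant sequence [\1_A] converges almost everywhere to [\1_B]. *)
Lemma trig_set_ae A B : trig_set A -> measurable B ->
  {ae mu, forall x, A x <-> B x} -> trig_set B.
Proof.
move=> [mA tA] mB AB; split => //.
apply: (@trig_closure_lim _ _ _ (fun=> \1_A) 1) => //.
- exact: normr_indic_le1.
- by move=> n x; exact: normr_indic_le1.
- apply: filterS AB => x AB.
  rewrite (_ : \1_B x = \1_A x); first exact: cvg_cst.
  rewrite !indicE; congr (_%:R); congr nat_of_bool.
  by apply/idP/idP; rewrite !inE => /AB.
Qed.

End density.

Lemma ae_imp disp (T : measurableType disp) (R : realType)
    (mu : {measure set T -> \bar R}) (P Q : T -> Prop) :
  (forall x, P x -> Q x) -> {ae mu, forall x, P x} -> {ae mu, forall x, Q x}.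
Proof. by move=> PQ; apply: filterS. Qed.

(** * Coordinate rays described by signs of trigonometric functions, up to null sets *)

Section coordinates.
Context (R : realType).
Local Notation RT := (measurableTypeR R).

(** Induction on the dimension: the preimage is a rectangle with a null side, either [A] itself or
    the preimage in one dimension less. *)
Lemma torus_null_coord d (j : 'I_d) (A : set RT) : measurable A ->
  circle_measure R A = 0%E ->
  torus_measure R d ((fun x : d.-tuple RT => tnth x j) @^-1` A) = 0%E.
Proof.
move=> mA A0; elim: d j => [[]//|d IH] j.
rewrite /= /torus_step /pushforward.
have mS i : measurable ((fun x : d.-tuple RT => tnth x i) @^-1` A).
  rewrite -[X in measurable X]setTI.
  by apply: (@measurable_tnth _ RT d i) => //; exact: measurableT.
case: (unliftP ord0 j) => [i ->|->].
  rewrite (_ : _ @^-1` _ = setT `*` ((fun x : d.-tuple RT => tnth x i) @^-1` A)).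
    rewrite product_measure1E//. rewrite [X in (_ * X)%E](_ : _ = 0%E) ?mule0//; exact: IH.
  by apply/seteqP; split => -[x y] /=; rewrite tnthS => // -[].
rewrite (_ : _ @^-1` _ = A `*` setT); last first.
  by apply/seteqP; split => -[x y] /=; rewrite tnth0 => // -[].
by rewrite product_measure1E// [X in (X * _)%E](_ : _ = 0%E) ?mul0e.
Qed.

(** The endpoint [2 * pi], where [cos] and [sin] take the same values as at 0, is discarded as a
    null point. *)
Lemma torus_ae_coord d (j : 'I_d) :
  {ae torus_measure R d, forall x, 0 <= tnth x j < 2 * pi}.
Proof.
pose B : set RT := ~` `[0%R, (2 * pi)%R[.
have mB : measurable B by apply: measurableC; exact: measurable_itv.
have pi0 : 0 <= 2 * pi :> R by rewrite mulr_ge0// pi_ge0.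
exists ((fun x : d.-tuple RT => tnth x j) @^-1` B); split.
- rewrite -[X in measurable X]setTI.
  by apply: (@measurable_tnth _ RT d j) => //; exact: measurableT.
- apply: torus_null_coord => //; rewrite /= /mfrestr /mrestr.
  rewrite (_ : B `&` _ = [set 2 * pi]); first by rewrite lebesgue_measure_set1.
  apply/seteqP; split => x /=; rewrite /B /= !in_itv/=.
    move=> [/negP + /andP[x0 x2]]; rewrite x0 /= -leNgt => x2'.
    by apply/le_anti/andP.
  by move=> ->; rewrite ltxx lexx pi0 andbF; split.
- by move=> x /= /negP xj; rewrite /B /= in_itv/=; exact/negP.
Qed.

Lemma cos_2piB (t : R) : cos (2 * pi - t) = cos t.
Proof. by rewrite addrC mulr_natl cosD2pi cosN. Qed.

Lemma sin_2piB (t : R) : sin (2 * pi - t) = - sin t.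
Proof. by rewrite addrC mulr_natl sinD2pi sinN. Qed.

(** Here [t > a] means [sin t < 0] or [cos t < cos a]. The disjunction is written with negations and
    strict lower bounds, to match [trig_setC], [trig_setI] and [trig_set_gt]. *)
Lemma lt_upper_arc (a t : R) : 0 <= a <= pi -> 0 <= t < 2 * pi ->
  (a < t) <-> ~ (~ 0 < - sin t /\ ~ - cos a < - cos t).
Proof.
move=> /andP[a0 api] /andP[t0 t2]; have [tpi|tpi] := leP t pi.
  have st : 0 <= sin t by rewrite sin_ge0_pi// t0.
  have ct : (- cos a < - cos t) = (a < t).
    by rewrite ltrN2 ltr_cos// in_itv/= ?t0 ?a0.
  rewrite ct; split => [->[_]//|H]; apply: contrapT => at_.
  by apply: H; split => //; lra.
have st : sin (2 * pi - t) > 0 by apply: sin_gt0_pi; lra.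
rewrite sin_2piB in st; split => [_ [] //|_]; exact: le_lt_trans tpi.
Qed.

(** On the lower half circle the cosine increases, as the reflection of [t] to [2 * pi - t]
    shows. *)
Lemma lt_lower_arc (a t : R) : pi < a < 2 * pi -> 0 <= t < 2 * pi ->
  (a < t) <-> (0 < - sin t /\ cos a < cos t).
Proof.
move=> /andP[api a2] /andP[t0 t2]; have [tpi|tpi] := leP t pi.
  have st : 0 <= sin t by rewrite sin_ge0_pi// t0.
  by split => [|[]]; lra.
have st : sin (2 * pi - t) > 0 by apply: sin_gt0_pi; lra.
rewrite sin_2piB in st.
rewrite -(cos_2piB a) -(cos_2piB t) ltr_cos ?in_itv/=; [|lra|lra].
by split => [at_|[_]]; [split|]; lra.
Qed.

End coordinates.

Import HBSimple HBNNSimple.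

(** * Completeness of the characters and Parseval's inequality *)

Section density.
Context (R : realType) (d : nat).
Local Notation RT := (measurableTypeR R).
Local Notation T := (d.-tuple RT).
Local Notation mu := (torus_measure R d).
Local Notation L2_torus := (L2 mu).
Implicit Types (p q : T -> R[i]) (f g : T -> R) (A B : set T) (j : 'I_d).

(** Up to a null set the ray is everything for [a < 0], empty for [a >= 2 * pi], and otherwise one
    of the two arcs. *)
Lemma trig_set_ray j (a : R) : trig_set [set x : T | a < tnth x j].
Proof.
have mray : measurable [set x : T | a < tnth x j].
  rewrite (_ : mkset _ = (fun x : T => tnth x j) @^-1` `]a, +oo[); last first.
    by apply/seteqP; split => x /=; rewrite in_itv/= andbT.
  rewrite -[X in measurable X]setTI.
  by apply: (@measurable_tnth _ RT d j) => //; exact: measurable_itv.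
have [tc ts] := @trig_closure_coord R d j.
have tN f : trig_closure f -> trig_closure (fun x => - f x).
  move=> tf; have := trig_closureZ (-1) tf.
  by congr trig_closure; apply/funext => x; rewrite mulN1r.
have tlow := trig_set_gt 0 (tN _ ts).
have aeC := @torus_ae_coord R d j.
have [a0|a0] := ltP a 0.
  apply: (trig_set_ae (trig_setC (trig_set0 R d))) => //.
  by apply: ae_imp aeC => x /andP[x0 _]; split => [_|_ []]; exact: lt_le_trans x0.
have [api|api] := leP a pi.
  have H := trig_setC (trig_setI (trig_setC tlow)
    (trig_setC (trig_set_gt (- cos a) (tN _ tc)))).
  apply: (trig_set_ae H mray).
  by apply: ae_imp aeC => x x2; apply: iff_sym; apply: lt_upper_arc => //; rewrite a0.
have [a2|a2] := ltP a (2 * pi).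
  have H := trig_setI tlow (trig_set_gt (cos a) tc).
  apply: (trig_set_ae H mray).
  by apply: ae_imp aeC => x x2; apply: iff_sym; apply: lt_lower_arc => //; rewrite api.
apply: (trig_set_ae (trig_set0 R d)) => //.
apply: ae_imp aeC => x /andP[_ x2]; split => //= ax.
by have := lt_trans ax (lt_le_trans x2 a2); rewrite ltxx.
Qed.

(** Generation is used twice: the product sigma-algebra comes from preimages under coordinates, and
    the Borel sets of the line come from open rays. *)
Lemma trig_set_measurable A : measurable A -> trig_set A.
Proof.
have sig : sigma_algebra setT (@trig_set R d).
  split; first exact: trig_set0.
  - by move=> B tB; rewrite setTD; exact: trig_setC.
  - by move=> F tF; exact: trig_set_bigcup.
apply: smallest_sub => // B; rewrite -bigcup_seq => -[j _ [C mC <-]].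
rewrite setTI.
have sigj : sigma_algebra setT
    [set D : set RT | trig_set ((fun x : T => tnth x j) @^-1` D)].
  split; first by rewrite /= preimage_set0; exact: trig_set0.
  - by move=> D tD; rewrite setTD /= preimage_setC; exact: trig_setC.
  - by move=> F tF; rewrite /= preimage_bigcup; exact: trig_set_bigcup.
move: mC; rewrite [measurable]RGenOInfty.measurableE.
move: C; apply: smallest_sub => // _ [a ->] /=.
have := trig_set_ray j a; congr trig_set.
by apply/seteqP; split => x /=; rewrite in_itv/= andbT.
Qed.

Lemma trig_closure_sum (I : Type) (r : seq I) (F : I -> T -> R) :
  (forall i, trig_closure (F i)) -> trig_closure (fun x => \sum_(i <- r) F i x).
Proof.
move=> tF; elim: r => [|i r IH].
  have := @trig_closure_cst R d 0; congr trig_closure.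
  by apply/funext => x; rewrite big_nil.
have := trig_closureD (tF i) IH; congr trig_closure.
by apply/funext => x; rewrite big_cons.
Qed.

Lemma trig_closure_bounded f : bounded_measurable f -> trig_closure f.
Proof.
move=> [mf [M fM]].
(* Adding [M] makes the function nonnegative, hence a pointwise limit of simple functions from
   below. *)
suff key g : measurable_fun setT g -> (forall x, 0 <= g x <= 2 * M) -> trig_closure g.
  have tg : trig_closure (fun x => f x + M).
    apply: key; first by apply: measurable_funD => //; exact: measurable_cst.
    by move=> x; have := fM x; rewrite ler_norml => /andP[]; lra.
  have := trig_closureD tg (@trig_closure_cst R d (- M)).
  by congr trig_closure; apply/funext => x; rewrite addrK.
move=> mg gM; have mg' : measurable_fun setT (EFin \o g) by exact/measurable_EFinP.
pose g_ := nnsfun_approx measurableT mg'.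
have g0 x : setT x -> (0 <= (EFin \o g) x)%E.
  by move=> _; rewrite lee_fin; have /andP[] := gM x.
have cg x : g_ n x @[n --> \oo] --> g x.
  have := cvg_nnsfun_approx measurableT mg' g0 (I : setT x).
  by move/fine_cvgP => [_].
have g_g n x : g_ n x <= g x.
  rewrite -(cvg_lim _ (cg x))//; apply: nondecreasing_cvgn_le.
    by move=> i k ik; exact/lefP/nd_nnsfun_approx.
  by apply/cvg_ex; exists (g x); exact: cg.
apply: (@trig_closure_lim _ _ _ (fun n => g_ n) (2 * M)) => //.
- by move=> x; have /andP[? ?] := gM x; rewrite ger0_norm.
- move=> n; rewrite (_ : (g_ n : T -> R) = fun x => \sum_(y <- fset_set (range (g_ n)))
      (y * \1_(g_ n @^-1` [set y]) x)); last first.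
    by apply/funext => x; rewrite fimfunE fsbig_finite.
  apply: trig_closure_sum => y; apply: trig_closureZ.
  by case: (@trig_set_measurable (g_ n @^-1` [set y])).
- move=> n x; rewrite ger0_norm ?(le_trans (g_g n x))//.
  by have /andP[] := gM x.
- by apply: aeW.
Qed.

(** Cutting [f] off at heights [n] and [-n] gives bounded functions; the error never exceeds [|f|],
    so [g] dominates its square. *)
Lemma trig_approx_real f (g : T -> R) : measurable_fun setT f ->
  mu.-integrable setT (EFin \o g) -> (forall x, f x ^+ 2 <= g x) ->
  trig_approx (fun x => (f x)%:C).
Proof.
move=> mf ig fg.
pose f_ n x := Num.max (- n%:R) (Num.min n%:R (f x)).
have mf_ n : measurable_fun setT (f_ n).
  by apply: measurable_maxr; [|apply: measurable_minr] => //; exact: measurable_cst.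
apply: (@trig_approx_lim _ _ _ (fun n x => (f_ n x)%:C)).
- exact: measurable_cfun_real.
- by move=> n; exact: measurable_cfun_real.
- move=> n; suff [] : trig_closure (f_ n) by [].
  apply: trig_closure_bounded; split => //; exists n%:R => x.
  by rewrite ler_norml le_max lexx ge_max ge_min lexx (le_trans _ (ler0n _ n))// oppr_le0.
apply: (@sqint_dominated_cvg _ _ _ g) => //.
- move=> n x; apply: le_trans (fg x); rewrite /f_.
  have n0 : 0 <= n%:R :> R by [].
  by case: (leP n%:R (f x)) => h1; case: (leP (- n%:R) _) => h2; nra.
- apply: aeW => x; apply: (@cvg_near_cst _ _ _ _ _ _ _).
  exists (Num.truncn `|f x|).+1 => // n /= nx.
  have : `|f x| <= n%:R.
    by rewrite (le_trans (ltW (truncnS_gt _)))// ler_nat.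
  rewrite ler_norml /f_ => /andP[h1 h2].
  by rewrite (min_idPr h2) (max_idPr h1).
Qed.

Lemma trig_approx_l2 (F : l2_fun mu) : trig_approx F.
Proof.
have := l2_fun_valP F; rewrite inE => -[[mr mi] _].
have iF := l2_fun_sq_integrable F.
have ar : trig_approx (fun x => (Re (F x))%:C).
  apply: trig_approx_real iF _ => // x.
  by rewrite normc_sqE lerDl sqr_ge0.
have ai : trig_approx (fun x => (Im (F x))%:C).
  apply: trig_approx_real iF _ => // x.
  by rewrite normc_sqE lerDr sqr_ge0.
have := trig_approxZD (0 +i* 1 : R[i])
  (measurable_cfun_real mi) (measurable_cfun_real mr) ai ar.
congr trig_approx; apply/funext => x.
rewrite [F x in RHS]complexE; apply/eqP; rewrite eq_complex /=.
by apply/andP; split; apply/eqP; ring.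
Qed.

(** Merges repeated frequencies, since the norm identities are stated for lists without
    repetition. *)
Lemma char_span_uniq (s : seq (R[i] * d.-tuple int)) :
  exists2 r : seq (d.-tuple int), uniq r & exists a : d.-tuple int -> R[i],
    \sum_(t <- s) t.1 *: char R t.2 = \sum_(k <- r) a k *: char R k.
Proof.
exists (undup (map snd s)); first exact: undup_uniq.
exists (fun k => \sum_(t <- s | t.2 == k) t.1).
under [RHS]eq_bigr do rewrite scaler_suml big_mkcond.
rewrite exchange_big /=; apply: eq_big_seq => t ts.
have tr : t.2 \in undup (map snd s) by rewrite mem_undup map_f.
rewrite (bigD1_seq t.2) ?undup_uniq//= eqxx big1 ?addr0// => k /negPf.
by rewrite eq_sym => ->.
Qed.

Lemma l2_fun_char_sumE (s : seq (R[i] * d.-tuple int)) x :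
  (\sum_(t <- s) t.1 *: char_l2 R t.2 : l2_fun mu) x =
  \sum_(t <- s) t.1 * char_fun t.2 x.
Proof.
elim: s => [|t s IH]; first by rewrite !big_nil.
by rewrite !big_cons -IH.
Qed.

Lemma pi_L2_char_sum (s : seq (R[i] * d.-tuple int)) :
  \pi_L2_torus (\sum_(t <- s) t.1 *: char_l2 R t.2) = \sum_(t <- s) t.1 *: char R t.2.
Proof.
elim: s => [|t s IH]; first by rewrite !big_nil pi_zeror.
by rewrite !big_cons pi_L2D pi_L2Z IH.
Qed.

(** For a trigonometric polynomial [P] with [|f - P| ^ 2 <= e], [L2_norm_sub_trig] gives
    [|f| ^ 2 <= e] plus the squared coefficients of [f] at the frequencies of [P]. *)
Lemma parseval_le (f : L2_torus) :
  ((L2_norm f ^+ 2)%:E <=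
    \esum_(k in [set: d.-tuple int]) (normc (fourier_coef k f) ^+ 2)%:E)%E.
Proof.
apply/lee_addgt0Pr => e e0.
have [_ [s ->] se] := trig_approx_l2 (repr f) e0.
have cs0 : char_scale R d != 0.
  apply/eqP => c0; have := @char_scale_sq R d.
  by rewrite c0 expr0n mul0r => /eqP; rewrite eq_sym oner_eq0.
(* Dividing by the normalising factor turns plain exponentials into the orthonormal characters. *)
pose s' := [seq (t.1 * (char_scale R d)^-1%:C, t.2) | t <- s].
have [r ur [a ra]] := char_span_uniq s'.
pose P : l2_fun mu := \sum_(t <- s') t.1 *: char_l2 R t.2.
have PE x : (-1 *: P + repr f) x = repr f x - \sum_(t <- s) t.1 * expi (torus_dot t.2 x).
  transitivity (-1 * P x + repr f x) => //; rewrite mulN1r addrC; congr (_ - _).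
  rewrite /P l2_fun_char_sumE big_map; apply: eq_bigr => t _.
  by rewrite /= /char_fun mulrA -[_ * _ * _%:C]mulrA -rmorphM mulVf// rmorph1 mulr1.
have fP : f - \sum_(k <- r) a k *: char R k = \pi_L2_torus (-1 *: P + repr f).
  by rewrite pi_L2D pi_L2Z reprK scaleN1r pi_L2_char_sum ra addrC.
have fPe : L2_norm (f - \sum_(k <- r) a k *: char R k) ^+ 2 <= e.
  rewrite fP L2_norm_sq_pi.
  have E : (\int[mu]_x (normc ((-1 *: P + repr f) x) ^+ 2)%:E <= e%:E)%E.
    apply: le_trans se; rewrite le_eqVlt; apply/orP; left; apply/eqP.
    by apply: eq_integral => x _; rewrite PE.
  rewrite -lee_fin fineK// ge0_fin_numE; first exact: le_lt_trans E (ltry _).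
  by apply: integral_ge0 => x _; rewrite lee_fin sqr_ge0.
have S0 : 0 <= \sum_(k <- r) normc (fourier_coef k f - a k) ^+ 2.
  by apply: sumr_ge0 => k _; rewrite sqr_ge0.
rewrite L2_norm_sub_trig// in fPe.
apply: (@le_trans _ _ ((\sum_(k <- r) normc (fourier_coef k f) ^+ 2)%:E + e%:E)%E).
  by rewrite -EFinD lee_fin; lra.
apply: leeD => //; apply: esum_ge; exists [set` r]; first by split; [exact: finite_seq|].
by rewrite -fsbig_seq// -sumEFin.
Qed.

End density.

(** * Approximation numbers *)

Section approximation.
Context (R : realType) (d : nat) (s : R).
Local Notation T := (d.-tuple (measurableTypeR R)).
Local Notation mu := (torus_measure R d).
Local Notation L2_torus := (L2 mu).
Local Notation H := (Hmix d s).
Implicit Types (k l : d.-tuple int) (r : seq (d.-tuple int)) (a : d.-tuple int -> R[i]).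

Definition cross_weight k : R := \prod_(j < d) (1 + `|tnth k j|%:~R).

Lemma cross_weight_ge1 k : 1 <= cross_weight k.
Proof.
apply: (big_ind (fun x => 1 <= x)) => // [x y x1 y1|j _]; first by rewrite mulr_ege1.
by rewrite lerDl ler0z.
Qed.

Lemma mix_weightE k : mix_weight s k = (cross_weight k `^ s) ^+ 2.
Proof.
rewrite /mix_weight -powR_mulrn ?powR_ge0// -powRrM [s * _]mulrC /cross_weight.
(* Nonnegativity is carried through the product because [powRM] asks for it. *)
pose P (x y : R) := 0 <= y /\ x = y `^ (2 * s).
suff [] : P (\prod_(j < d) (1 + `|tnth k j|%:~R) `^ (2 * s))
    (\prod_(j < d) (1 + `|tnth k j|%:~R)) by [].
apply: (big_ind2 P) => [|x1 x2 y1 y2 [x0 ->] [y0 ->]|j _].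
- by split; rewrite ?powR1.
- by split; [exact: mulr_ge0|rewrite powRM].
- by split => //; rewrite addr_ge0// ler0z.
Qed.

Lemma mix_weight_ge1 k : 0 < s -> 1 <= mix_weight s k.
Proof.
move=> s0; rewrite mix_weightE exprn_ege1// -[1](powRr0 (cross_weight k)).
by rewrite ler_powR ?cross_weight_ge1// ltW.
Qed.

Lemma mix_sqnorm_trig r a : uniq r ->
  mix_sqnorm s (\sum_(k <- r) a k *: char R k) =
  (\sum_(k <- r) normc (a k) ^+ 2 * mix_weight s k)%:E.
Proof.
move=> ur; pose u k := (normc (a k) ^+ 2 * mix_weight s k)%:E.
have u0 k : (0 <= u k)%E by rewrite lee_fin mulr_ge0 ?sqr_ge0// mix_weight_ge0.
transitivity (\esum_(k in [set` r]) u k).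
  rewrite esum_mkcond; apply: eq_esum => k _; rewrite fourier_coef_trig//.
  rewrite (_ : (k \in [set` r]) = (k \in r)); last by apply/idP/idP; rewrite inE.
  by case: ifP => // _; rewrite normc0 expr0n mul0r.
rewrite esum_fset//; last exact: finite_seq.
by rewrite -fsbig_seq// sumEFin.
Qed.

Lemma trig_Hmix r a : uniq r -> (\sum_(k <- r) a k *: char R k) \in @Hmix_pred R d s.
Proof. by move=> ur; apply: mem_set; rewrite /= mix_sqnorm_trig// ltry. Qed.

Lemma char_Hmix k : char R k \in @Hmix_pred R d s.
Proof.
have := @trig_Hmix [:: k] (fun=> 1) erefl.
by rewrite big_seq1 scale1r.
Qed.

Definition Hmix_char k : H := HMix (char_Hmix k).

Lemma mix_sqnorm_ge0 (f : L2_torus) : (0 <= mix_sqnorm s f)%E.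
Proof.
by apply: esum_ge0 => k _; rewrite lee_fin mulr_ge0 ?sqr_ge0// mix_weight_ge0.
Qed.

(** [Hmix_norm] goes through [fine], which sends an infinite sum to 0; membership in [Hmix] excludes
    that case. *)
Lemma Hmix_norm_le1 (f : H) : Hmix_norm f <= 1 -> (mix_sqnorm s (val f) <= 1%:E)%E.
Proof.
have /set_mem/= fin := Hmix_valP f; have ge0 := mix_sqnorm_ge0 (val f).
rewrite /Hmix_norm; move: fin ge0; case: mix_sqnorm => [x| |]//= _.
rewrite !lee_fin => x0; rewrite -[X in _ <= X]sqrtr1 ler_sqrt//.
Qed.

Definition truncation r (f : H) : L2_torus :=
  \sum_(k <- r) fourier_coef k (val f) *: char R k.

Lemma truncation_is_linear r : linear (truncation r).
Proof.
move=> b f g; rewrite /truncation scaler_sumr -big_split; apply: eq_bigr => k _ /=.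
rewrite [X in fourier_coef k X](_ : _ = b *: val f + val g); last first.
  exact: (linearP (Hmix_embedding d s)).
by rewrite fourier_coefZD scalerDl scalerA.
Qed.

HB.instance Definition _ r := GRing.isLinear.Build R[i] H L2_torus *:%R
  (truncation r) (truncation_is_linear r).

Lemma truncation_bounded r : 0 < s -> uniq r ->
  (op_norm (@Hmix_norm R d s) (@L2_norm _ _ R mu) (truncation r) < +oo)%E.
Proof.
move=> s0 ur; apply: (@le_lt_trans _ _ 1%:E); last exact: ltry.
apply: ge_ereal_sup => _ [f /= /Hmix_norm_le1 f1 <-]; rewrite lee_fin.
rewrite -(@ler_pXn2r _ 2) // ?nnegrE ?sqrtr_ge0// expr1n /truncation L2_norm_trig//.
rewrite -lee_fin; apply: le_trans f1; apply: esum_ge; exists [set` r].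
  by split => //; exact: finite_seq.
rewrite -fsbig_seq// sumEFin lee_fin; apply: ler_sum => k _.
by rewrite ler_peMr ?sqr_ge0// mix_weight_ge1.
Qed.

Lemma truncation_has_rank r : uniq r -> has_rank (truncation r) (size r).
Proof.
move=> ur; exists (fun i => char R (tnth (in_tuple r) i)).
(* Passes from coefficients indexed by position to coefficients indexed by frequency; the default 0
   is never reached for [k] in [r]. *)
have sumE (c : 'I_(size r) -> R[i]) : \sum_i c i *: char R (tnth (in_tuple r) i) =
    \sum_(k <- r) (if insub (index k r) is Some i then c i else 0) *: char R k.
  rewrite [RHS]big_tnth; apply: eq_bigr => i _; congr (_ *: _).
  rewrite (tnth_nth (tnth (in_tuple r) i)) index_uniq//=.
  by rewrite valK.
split.
- move=> i; exists (Hmix_char (tnth (in_tuple r) i)) => //.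
  rewrite /truncation /= (bigD1_seq (tnth (in_tuple r) i)) ?mem_tnth//=.
  rewrite fourier_coef_char eqxx scale1r big1 ?addr0// => k /negPf ki.
  by rewrite fourier_coef_char eq_sym ki scale0r.
- move=> c; rewrite sumE => c0 i.
  have := @fourier_coef_trig R d r _ (tnth (in_tuple r) i) ur.
  move=> /(_ (fun k => if insub (index k r) is Some i then c i else 0)).
  rewrite c0 fourier_coef0 mem_tnth (tnth_nth (tnth (in_tuple r) i)) index_uniq//=.
  by rewrite valK.
- move=> f; exists (fun i => fourier_coef (tnth (in_tuple r) i) (val f)).
  by rewrite /truncation big_tnth.
Qed.

Lemma esumZ_le (c : R) (u : d.-tuple int -> R) : 0 <= c -> (forall k, 0 <= u k) ->
  (\esum_(k in [set: d.-tuple int]) (c * u k)%:E <=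
   c%:E * \esum_(k in [set: d.-tuple int]) (u k)%:E)%E.
Proof.
move=> c0 u0; apply: ge_ereal_sup => _ [X [finX _] <-].
rewrite (eq_fsbigr (fun k => c%:E * (u k)%:E)%E)// -ge0_mule_fsumr//.
by apply: lee_wpmul2l => //; apply: esum_ge; exists X.
Qed.

(** The error has no coefficients in [r], and outside [r] one has [1 <= (W(k) / x) ^ (2 s)], so its
    squared norm is at most [x ^ (- 2 s)] times the mixed one. *)
Lemma truncation_error r (x : R) (f : H) : 0 < s -> uniq r -> 0 < x ->
  (forall k, k \notin r -> x <= cross_weight k) -> Hmix_norm f <= 1 ->
  L2_norm (val f - truncation r f) <= x^-1 `^ s.
Proof.
move=> s0 ur x0 xr /Hmix_norm_le1 f1.
have x's : 0 <= x^-1 `^ s by exact: powR_ge0.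
rewrite -(@ler_pXn2r _ 2) // ?nnegrE ?sqrtr_ge0// -lee_fin.
apply: le_trans (parseval_le _) _.
have u0 k : 0 <= normc (fourier_coef k (val f)) ^+ 2 * mix_weight s k.
  by rewrite mulr_ge0 ?sqr_ge0// mix_weight_ge0.
apply: (@le_trans _ _ (\esum_(k in [set: d.-tuple int])
    ((x^-1 `^ s) ^+ 2 * (normc (fourier_coef k (val f)) ^+ 2 * mix_weight s k))%:E)).
  apply: le_esum => k _; rewrite lee_fin fourier_coefB fourier_coef_trig//.
  case: ifPn => [_|kr]; first by rewrite subrr normc0 expr0n mulr_ge0 ?sqr_ge0.
  rewrite subr0 mulrCA ler_peMr ?sqr_ge0// mix_weightE -exprMn exprn_ege1//.
  rewrite -powRM ?invr_ge0 ?(ltW x0)//; last first.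
    by rewrite (le_trans _ (cross_weight_ge1 k)).
  rewrite -[leLHS](_ : 1 `^ s = 1); last by rewrite powR1.
  rewrite ge0_ler_powR ?nnegrE ?(ltW s0)//.
    by rewrite mulr_ge0 ?invr_ge0 ?(ltW x0)// (le_trans _ (cross_weight_ge1 k)).
  by rewrite mulrC ler_pdivlMr// mul1r xr.
apply: le_trans (esumZ_le _ u0) _; first by rewrite sqr_ge0.
apply: le_trans (lee_wpmul2l _ f1) _; first by rewrite lee_fin sqr_ge0.
by rewrite mule1.
Qed.

Lemma approx_number_le r (x : R) n : 0 < s -> uniq r -> 0 < x -> (size r < n)%N ->
  (forall k, k \notin r -> x <= cross_weight k) ->
  (approx_number (@Hmix_norm R d s) (@L2_norm _ _ R mu) (Hmix_embedding d s) n
    <= (x^-1 `^ s)%:E)%E.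
Proof.
move=> s0 ur x0 rn xr.
apply: (@le_trans _ _ (op_norm (@Hmix_norm R d s) (@L2_norm _ _ R mu)
    (fun f => Hmix_embedding d s f - truncation r f))).
  apply: ereal_inf_lbound; exists (truncation r : {linear H -> L2_torus}) => //.
  split; first exact: truncation_bounded.
  by exists (size r) => //; exact: truncation_has_rank.
apply: ge_ereal_sup => _ [f /= f1 <-]; rewrite lee_fin.
exact: truncation_error.
Qed.

(** The coordinates of the vectors [A (h i)] form a matrix with more rows than columns, whose left
    kernel is therefore nonzero. *)
Lemma kernel_combination (X Y : lmodType R[i]) (A : {linear X -> Y}) (m N : nat)
    (h : 'I_N -> X) : (m < N)%N -> has_rank A m ->
  exists2 v : 'I_N -> R[i], exists i, v i != 0 & A (\sum_i v i *: h i) = 0.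
Proof.
move=> mN [e [_ _ span]].
have [c cP] := choice (fun i => span (h i)).
pose M := \matrix_(i < N, j < m) c i j.
have kM : kermx M != 0.
  rewrite -mxrank_eq0 mxrank_ker subn_eq0 -ltnNge.
  exact: leq_ltn_trans (rank_leq_col M) mN.
have /eqP vM : nz_row (kermx M) *m M == 0 by rewrite -sub_kermx nz_row_sub.
set v := nz_row _ in vM.
exists (fun i => v 0 i).
  have : v != 0 by rewrite nz_row_eq0.
  by move/rV0Pn.
rewrite linear_sum /=.
under eq_bigr do rewrite linearZ /= cP scaler_sumr.
rewrite exchange_big /= big1// => j _.
under eq_bigr do rewrite scalerA.
rewrite -scaler_suml (_ : \sum_i _ = (v *m M) 0 j); first by rewrite vM mxE scale0r.
by rewrite mxE; apply: eq_bigr => i _; rewrite mxE.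
Qed.

(** The test vector is a combination of characters from [r] killed by [A]; on it the embedding minus
    [A] is just the embedding, which bounds the operator norm below. *)
Lemma approx_number_ge r (x : R) n : 0 < s -> uniq r -> 0 < x -> (n <= size r)%N ->
  (forall k, k \in r -> cross_weight k <= x) ->
  ((x^-1 `^ s)%:E <=
    approx_number (@Hmix_norm R d s) (@L2_norm _ _ R mu) (Hmix_embedding d s) n)%E.
Proof.
move=> s0 ur x0 nr xr; apply: le_ereal_inf_tmp => _ [A [_ [m mn rkA]] <-].
have [v [i0 vi0] Av] := kernel_combination (fun i => Hmix_char (tnth (in_tuple r) i))
  (leq_trans mn nr) rkA.
pose a k := if insub (index k r) is Some i then v i else 0.
have vE (z : R[i]) : val (z *: \sum_i v i *: Hmix_char (tnth (in_tuple r) i)) =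
    \sum_(k <- r) (z * a k) *: char R k.
  transitivity (z *: \sum_i v i *: char R (tnth (in_tuple r) i)).
    by rewrite -[LHS]/(Hmix_embedding d s _) linearZ linear_sum; congr (_ *: _).
  rewrite scaler_sumr [RHS]big_tnth.
  apply: eq_bigr => i _; rewrite scalerA; congr (_ * _ *: _).
  by rewrite /a (tnth_nth (tnth (in_tuple r) i)) index_uniq//= valK.
pose S := \sum_(k <- r) normc (a k) ^+ 2 * mix_weight s k.
have S0 : 0 < S.
  rewrite /S (bigD1_seq (tnth (in_tuple r) i0)) ?mem_tnth//= ltr_wpDr//.
    by apply: sumr_ge0 => k _; rewrite mulr_ge0 ?sqr_ge0// mix_weight_ge0.
  rewrite mulr_gt0//; last by rewrite (lt_le_trans _ (mix_weight_ge1 _ s0)).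
  rewrite /a (tnth_nth (tnth (in_tuple r) i0)) index_uniq//= valK.
  rewrite lt0r sqr_ge0 andbT expf_eq0 /=.
  by apply: contra vi0 => /eqP/eq0_normc ->.
(* Scales the killed combination to mixed norm exactly 1. *)
pose z : R[i] := ((Num.sqrt S)^-1)%:C.
have nz : normc z ^+ 2 = S^-1.
  by rewrite normc_sqE /= expr0n addr0 exprVn sqr_sqrtr// ltW.
pose f : H := z *: \sum_i v i *: Hmix_char (tnth (in_tuple r) i).
have Sz : \sum_(k <- r) normc (z * a k) ^+ 2 * mix_weight s k = 1.
  under eq_bigr do rewrite normcM exprMn nz -mulrA.
  by rewrite -mulr_sumr mulVf// gt_eqF.
apply: (@le_trans _ _ (L2_norm (Hmix_embedding d s f - A f))%:E); last first.
  apply: ereal_sup_ubound; exists f => //=.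
  by rewrite /Hmix_norm vE mix_sqnorm_trig// Sz sqrtr1.
have Af : A f = 0 by rewrite /f linearZZ Av scaler0.
rewrite Af subr0 lee_fin.
rewrite -(@ler_pXn2r _ 2) // ?nnegrE ?sqrtr_ge0 ?powR_ge0//.
rewrite (vE z : Hmix_embedding d s f = _) L2_norm_trig//.
(* After multiplication by [x ^ (2 s)] the claim compares 1, written as the weighted sum [Sz], with
   the unweighted sum term by term, by [W(k) <= x]. *)
rewrite -(@ler_pM2r _ ((x `^ s) ^+ 2)) ?exprn_gt0 ?powR_gt0// -exprMn.
rewrite -powRM ?invr_ge0 ?(ltW x0)// mulVf ?gt_eqF// powR1 /= expr1n -Sz mulr_suml.
rewrite [leLHS]big_seq [leRHS]big_seq; apply: ler_sum => k kr.
rewrite ler_wpM2l ?sqr_ge0// mix_weightE lerXn2r ?nnegrE ?powR_ge0//.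
by rewrite ge0_ler_powR ?nnegrE ?(ltW s0) ?(ltW x0) ?xr// (le_trans _ (cross_weight_ge1 k)).
Qed.

End approximation.

End torus_analysis.

Theorem theorem4p5 (R : realType) (s : R) (d n : nat)
    (s_gt0 : 0 < s) (d_gt0 : (0 < d)%N) (n_gt0 : (0 < n)%N) :
  ((27 ^ d <= n)%N ->
    (approx_number (@Hmix_norm R d s) (@L2_norm _ _ R (torus_measure R d))
       (Hmix_embedding d s) n
     <= ((3 ^+ d / (d.-1)`!%:R) `^ s
         * (ln n%:R `^ (d.-1%:R * s) / n%:R `^ s))%:E)%E) /\
  ((12 * expR 2) ^+ d < n%:R :> R ->
    (((3 / d`!%:R * (2 / (2 + ln 12)) ^+ d) `^ s
         * (ln n%:R `^ (d.-1%:R * s) / n%:R `^ s))%:E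
     <= approx_number (@Hmix_norm R d s) (@L2_norm _ _ R (torus_measure R d))
          (Hmix_embedding d s) n)%E).
Proof.
case: d d_gt0 => // d _; rewrite [d.+1.-1]/=.
have n0 : 0 < n%:R :> R by rewrite ltr0n.
have ln_ge1 : 27 <= n%:R :> R -> 1 <= ln n%:R :> R.
  move=> n27. apply: (@le_trans _ _ (ln (3 ^+ 3 : R))); last first.
    by rewrite ler_ln ?posrE//; lra.
  by rewrite lnX//; have := ln3_ge R; lra.
split => [dn|dn].
- have {}ln_ge1 : 1 <= ln n%:R :> R.
    apply: ln_ge1; rewrite (ler_nat R 27); apply: leq_trans dn.
    by rewrite expnS leq_pmulr// expn_gt0.
  have ln0 : 0 < ln n%:R :> R by apply: lt_le_trans ln_ge1.
  have A0 : 0 < 3 ^+ d.+1 / d`!%:R :> R.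
    by rewrite divr_gt0 ?exprn_gt0// ltr0n fact_gt0.
  (* Here [x] is the rate before the power [s], and the cross of radius [x^-1] is used. *)
  rewrite powR_rate// ?(ltW A0)//; set x := _ * _ / _; rewrite -[x]invrK.
  have x0 : 0 < x by rewrite divr_gt0// mulr_gt0// exprn_gt0.
  apply: (approx_number_le s_gt0 (hyperbolic_cross_uniq d.+1 x^-1)).
  + by rewrite invr_gt0.
  + exact: cross_count_lt dn.
  + by move=> k; rewrite mem_hyperbolic_cross -ltNge => /ltW.
- have e2 : 3 <= expR 2 :> R by apply: le_trans (expR_ge1Dx _); lra.
  have {}ln_ge1 : 1 <= ln n%:R :> R.
    (* The threshold exceeds 27 because [12 * expR 2 >= 36]. *)
    apply: ln_ge1; rewrite ltW//; apply: le_lt_trans dn.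
    rewrite exprS (@le_trans _ _ (12 * expR 2))//; first by lra.
    by rewrite ler_peMr ?exprn_ege1//; lra.
  have ln0 : 0 < ln n%:R :> R by apply: lt_le_trans ln_ge1.
  have A0 : 0 < 3 / d.+1`!%:R * (2 / (2 + ln 12)) ^+ d.+1 :> R.
    rewrite mulr_gt0 ?divr_gt0 ?ltr0n ?fact_gt0// exprn_gt0// divr_gt0//.
    by have := ln12E R; have := ln2_ge R; have := ln3_ge R; lra.
  rewrite powR_rate// ?(ltW A0)//; set x := _ * _ / _; rewrite -[x]invrK.
  have x0 : 0 < x by rewrite divr_gt0// mulr_gt0// exprn_gt0.
  apply: (approx_number_ge s_gt0 (hyperbolic_cross_uniq d.+1 x^-1)).
  + by rewrite invr_gt0.
  + exact: cross_count_ge dn.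
  + by move=> k; rewrite mem_hyperbolic_cross.
Qed.
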